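(* Let $(X,\langle\cdot,\cdot\rangle)$ be a real Hilbert space with norm $|\cdot|$, let $B:\mathfrak D(B)\to X$ be the generator of a strongly continuous semigroup on $X$, let $\zeta:[-1,0]\to L(X)$ be of bounded variation, and let $\Phi: W^{1,2}([-1,0];X)\to X$ be the bounded linear operator $\Phi f=\int_{-1}^0 d\zeta(s)\, f(s)$. Let $A$ be the operator on $X\times L^2([-1,0];X)$ given by $$A\begin{pmatrix} x\\ f\end{pmatrix}=\begin{pmatrix} Bx+\Phi f\\ \frac{d}{d\sigma}f\end{pmatrix},\qquad \mathfrak D(A)=\left\{\begin{pmatrix} x\\ f\end{pmatrix}\in \mathfrak D(B)\times W^{1,2}([-1,0];X): f(0)=x\right\}.$$ Let $\lambda\in\mathbb R$ be such that $B-\lambda I$ is dissipative, and suppose that $\mu>\lambda$ satisfies $$(\mu-\lambda)^2>\bigl(|\zeta|(0)-|\zeta|(-1)\bigr)\int_{-1}^0 e^{2\mu r}\,d|\zeta|(r).$$ Define $\tau:[-1,0]\to\mathbb R$ by $$\tau(t)=e^{-2\mu t}\left[\mu-\lambda-\frac{|\zeta|(0)-|\zeta|(-1)}{\mu-\lambda}\int_t^0 e^{2\mu r}\,d|\zeta|(r)\right].$$ Then $$\left(\begin{pmatrix} c\\ f\end{pmatrix},\begin{pmatrix} d\\ g\end{pmatrix}\right):=\langle c,d\rangle+\int_{-1}^0\tau(s)\langle f(s),g(s)\rangle\,ds,\qquad c,d\in X,\ f,g\in L^2([-1,0];X),$$ defines an inner product on $X\times L^2([-1,0];X)$ that is equivalent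 to the canonical inner product, and $A-\mu I$ is dissipative with respect to $(\cdot,\cdot)$.
   Context: $L(X)$ denotes the bounded linear operators on $X$ with the operator norm $\|\cdot\|$. $W^{1,2}([-1,0];X)$ is the Sobolev space of (classes of) functions in $L^2([-1,0];X)$ with weak derivative in $L^2([-1,0];X)$; its elements are identified with their continuous representatives. For $\zeta:[-1,0]\to L(X)$ of bounded variation, $|\zeta|:[-1,0]\to\mathbb R$ denotes its total variation function, $|\zeta|(t)=\sup\sum_i\|\zeta(t_{i+1})-\zeta(t_i)\|$, the supremum being over all partitions $-1=t_0<t_1<\dots<t_n=t$ of $[-1,t]$ (so $|\zeta|(-1)=0$). Integrals $\int_{-1}^0 d\zeta(s)f(s)$ and $\int_t^0 h(r)\,d|\zeta|(r)$ of continuous functions are Lebesgue-Stieltjes integrals; for continuous integrands they are understood to agree with the Riemann-Stieltjes integrals over the closed interval, so jumps at the end points of the interval of integration (as determined by the values of the integrator on that closed interval) are included. A linear operator $A:\mathfrak D(A)\to H$ with $\mathfrak D(A)\subset H$, $H$ a Hilbert space with inner product $\langle\cdot,\cdot\rangle$, is dissipative (with respect to $\langle\cdot,\cdot\rangle$) if $\langle Ax,x\rangle\le 0$ for all $x\in\mathfrak D(A)$. The canonical inner product on $X\times L^2([-1,0];X)$ is $\langle c,d\rangle+\int_{-1}^0\langle f(s),g(s)\rangle\,ds$. Two inner products are equivalent if they induce equivalent norms. *)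

(* Defs.v *)
From HB Require Import structures.
From mathcomp Require Import all_boot all_order all_algebra.
From mathcomp Require Import all_classical all_reals all_analysis.
From mathcomp Require Import measurable_realfun ring.

Set Implicit Arguments.
Unset Strict Implicit.
Unset Printing Implicit Defensive.

Import Order.TTheory GRing.Theory Num.Theory.
Import numFieldNormedType.Exports.

Local Open Scope classical_set_scope.
Local Open Scope ring_scope.

Section InnerProduct.
Context {R : realType} {V : lmodType R}.
Implicit Types p q : V -> V -> R.

Definition is_inner_product p : Prop :=
  [/\ forall x y, p x y = p y x,
      forall a x y z, p (a *: x + y) z = a * p x z + p y z,
      forall x, 0 <= p x x
    & forall x, p x x = 0 -> x = 0].

Definition ip_norm p (x : V) : R := Num.sqrt (p x x).

Definition equivalent_ip p q : Prop :=
  exists a b : R, [/\ 0 < a, 0 < b &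
    forall x, a * ip_norm q x <= ip_norm p x <= b * ip_norm q x].

End InnerProduct.

(* The norm of X is the one induced by the inner product; completeness is part
   of completeNormedModType. *)
Definition is_hilbert {R : realType} {X : completeNormedModType R}
    (ip : X -> X -> R) : Prop :=
  is_inner_product ip /\ forall x, `|x| = ip_norm ip x.

(* Only the values of [op_fun] on [op_dom] are meaningful. *)
Record operator (V : Type) := Operator { op_dom : set V ; op_fun : V -> V }.

Definition op_sub_scalar {R : realType} {V : lmodType R}
    (A : operator V) (a : R) : operator V :=
  Operator (op_dom A) (fun x => op_fun A x - a *: x).

Definition dissipative {R : realType} {V : lmodType R}
    (p : V -> V -> R) (A : operator V) : Prop :=
  forall x, op_dom A x -> p (op_fun A x) x <= 0.

Section Semigroup.
Context {R : realType} {X : completeNormedModType R}.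

Definition bounded_op (T : X -> X) : Prop :=
  exists M : R, forall x, `|T x| <= M * `|x|.

Definition op_norm (T : X -> X) : R := sup [set `|T x| | x in [set x | `|x| <= 1]].

(* Only the values [S t] for [0 <= t] are meaningful. *)
Definition C0_semigroup (S : R -> {linear X -> X}) : Prop :=
  [/\ forall t, 0 <= t -> bounded_op (S t),
      forall x, S 0 x = x,
      forall s t x, 0 <= s -> 0 <= t -> S (s + t) x = S s (S t x)
    & forall x, S t x @[t --> 0^'+] --> x].

Definition is_generator_of (S : R -> {linear X -> X}) (B : operator X) : Prop :=
  (forall x, op_dom B x <-> cvg (h^-1 *: (S h x - x) @[h --> 0^'+])) /\
  (forall x, op_dom B x -> h^-1 *: (S h x - x) @[h --> 0^'+] --> op_fun B x).

Definition generates_C0_semigroup (B : operator X) : Prop :=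
  exists2 S, C0_semigroup S & is_generator_of S B.

End Semigroup.

(* In [itv_partition a b s] the subdivision points of [a, b] are a :: s, in
   strictly increasing order; if a = b then s is empty. *)
Section Stieltjes.
Context {R : realType}.

Definition node (a : R) (s : seq R) (i : nat) : R := nth a (a :: s) i.

Section Variation.
Context {X : completeNormedModType R}.
Implicit Type zeta : R -> X -> X.

Definition op_variation zeta (a : R) (s : seq R) : R :=
  \sum_(i < size s) op_norm (zeta (node a s i.+1) - zeta (node a s i)).

Definition op_variations zeta (a b : R) : set R :=
  [set op_variation zeta a s | s in itv_partition a b].

Definition op_bounded_variation zeta (a b : R) : Prop :=
  has_ubound (op_variations zeta a b).

Definition op_total_variation zeta (a b : R) : R := sup (op_variations zeta a b).

End Variation.

(* The integrator takes its values in U, the integrand in V, and [op] is the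
   pairing. *)
Section RiemannStieltjes.
Context {U : zmodType} {V : Type} {W : normedModType R}.
Variable op : U -> V -> W.

Definition RS_sum (z : R -> U) (f : R -> V) (a : R) (s : seq R) (xi : nat -> R)
    : W :=
  \sum_(i < size s) op (z (node a s i.+1) - z (node a s i)) (f (xi i)).

Definition is_RS_integral (z : R -> U) (f : R -> V) (a b : R) (I : W) : Prop :=
  forall eps : R, 0 < eps -> exists2 delta : R, 0 < delta &
    forall (s : seq R) (xi : nat -> R), itv_partition a b s ->
      (forall i, (i < size s)%N ->
         node a s i.+1 - node a s i < delta /\
         node a s i <= xi i <= node a s i.+1) ->
      `|RS_sum z f a s xi - I| < eps.

Definition RS_integral (z : R -> U) (f : R -> V) (a b : R) : W :=
  xget 0 [set I | is_RS_integral z f a b I].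

End RiemannStieltjes.

(* Jumps of the integrator at a and b count, as determined by its values on
   [a, b]. *)
Definition RS_integral_op {X : completeNormedModType R}
    (zeta : R -> X -> X) (f : R -> X) (a b : R) : X :=
  RS_integral (fun (T : X -> X) (x : X) => T x) zeta f a b.

Definition RS_integral_real (v h : R -> R) (a b : R) : R :=
  RS_integral (fun dv x : R => x * dv) v h a b.

End Stieltjes.

Section Itv.
Context {R : realType}.

Definition I10 : set R := `[(-1)%R, 0%R]%classic.

Lemma measurable_I10 : measurable (I10 : set (measurableTypeR R)).
Proof. exact: measurable_itv. Qed.

End Itv.

Local Notation leb := (@lebesgue_measure _).

Section StronglyMeasurable.
Context {R : realType} {X : completeNormedModType R}.

Definition simple_fun (s : R -> X) : Prop :=
  finite_set (range s) /\
  forall v, measurable (s @^-1` [set v] : set (measurableTypeR R)).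

(* Every class of almost everywhere limits of simple functions contains an
   everywhere limit, so that nothing is lost by requiring convergence at every
   point of the interval; the representatives are then Borel functions. *)
Definition strongly_measurable (f : R -> X) : Prop :=
  exists2 s : nat -> R -> X, (forall n, simple_fun (s n)) &
    forall t, I10 t -> s n t @[n --> \oo] --> f t.

Definition square_integrable (f : R -> X) : Prop :=
  (\int[leb]_(t in I10) (`|f t| ^+ 2)%:E < +oo)%E.

Lemma simple_fun_comp2 (g : X -> X -> X) (s t : R -> X) :
  simple_fun s -> simple_fun t -> simple_fun (fun x => g (s x) (t x)).
Proof.
move=> [fs ms] [ft mt]; split.
  have : finite_set [set g u.1 u.2 | u in range s `*` range t].
    by apply: finite_image; exact: finite_setX.
  apply: sub_finite_set => _ [x _ <-] /=.
  by exists (s x, t x) => //=; split; exists x.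
move=> v.
have -> : (fun x => g (s x) (t x)) @^-1` [set v] =
    \bigcup_(u in (range s `*` range t) `&` [set u | g u.1 u.2 = v])
      (s @^-1` [set u.1] `&` t @^-1` [set u.2]).
  apply/seteqP; split=> [x /= gx|x /= [u [_ /= guv] [/= -> ->]]] //.
  by exists (s x, t x) => //; split => //=; split; exists x.
apply: fin_bigcup_measurable.
  by apply: finite_setIl; exact: finite_setX.
by move=> u _; apply: measurableI.
Qed.

Lemma simple_fun_norm (s : R -> X) : simple_fun s ->
  measurable_fun (setT : set (measurableTypeR R)) (fun x => `|s x| : R).
Proof.
move=> [fs ms] _ Y mY; rewrite setTI.
have -> : (fun x => `|s x|) @^-1` Y =
    \bigcup_(v in range s `&` [set v | Y `|v| ]) (s @^-1` [set v]).
  apply/seteqP; split=> [x /= Yx|x /= [v [_ /= Yv] /= ->]] //.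
  by exists (s x) => //; split=> //; exists x.
apply: fin_bigcup_measurable; first exact: finite_setIl.
by move=> v _; exact: ms.
Qed.

Lemma strongly_measurable_norm (f : R -> X) : strongly_measurable f ->
  measurable_fun (I10 : set (measurableTypeR R)) (fun x => `|f x| : R).
Proof.
move=> [s ss sf].
apply: (@measurable_fun_cvg _ _ _ _ (fun n x => `|s n x|)).
  move=> n; apply: (@measurable_funS _ _ _ _ setT) => //.
  exact: simple_fun_norm.
by move=> x Dx; apply: cvg_norm; exact: sf.
Qed.

Lemma strongly_measurable_lin (a : R) (f g : R -> X) :
  strongly_measurable f -> strongly_measurable g ->
  strongly_measurable (a *: f + g).
Proof.
move=> [s ss sf] [t tt tg].
exists (fun n x => a *: s n x + t n x).
  by move=> n; apply: (simple_fun_comp2 (fun u v => a *: u + v)).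
move=> x Dx; apply: cvgD; last exact: tg.
by apply: cvgZr; exact: sf.
Qed.

Lemma square_integrable_lin (a : R) (f g : R -> X) :
  strongly_measurable f -> strongly_measurable g ->
  square_integrable f -> square_integrable g ->
  square_integrable (a *: f + g).
Proof.
move=> mf mg lf lg.
have mI : measurable (I10 : set (measurableTypeR R)) := measurable_I10.
have msq (h : R -> X) : strongly_measurable h ->
    measurable_fun (I10 : set (measurableTypeR R)) (fun x => (`|h x| ^+ 2)%:E).
  move=> mh; apply/measurable_EFinP; apply: measurable_funX.
  exact: strongly_measurable_norm.
apply: (@le_lt_trans _ _
  (\int[leb]_(t in I10) ((2 * `|a| ^+ 2)%:E * (`|f t| ^+ 2)%:E +
                         2%:E * (`|g t| ^+ 2)%:E))%E).
  apply: ge0_le_integral => //.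
  - by apply: msq; exact: strongly_measurable_lin.
  - by apply: emeasurable_funD; apply: measurable_funeM; exact: msq.
  move=> x _; rewrite -!EFinM -EFinD lee_fin.
  have h1 : `|(a *: f + g) x| <= `|a| * `|f x| + `|g x|.
    by rewrite -normrZ; exact: ler_normD.
  apply: (@le_trans _ _ ((`|a| * `|f x| + `|g x|) ^+ 2)).
    by rewrite lerXn2r// nnegrE ?addr_ge0// mulr_ge0.
  rewrite -mulrA -exprMn.
  set u := `|a| * _; set v := `|g x|.
  rewrite -subr_ge0 (_ : _ - _ = (u - v) ^+ 2) ?sqr_ge0//.
  by ring.
rewrite ge0_integralD//; try by [move=> *; rewrite -EFinM lee_fin ?mulr_ge0// sqr_ge0
  |apply: measurable_funeM; exact: msq].
rewrite !ge0_integralZl//; try exact: msq.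
all: try by move=> *; rewrite lee_fin ?mulr_ge0// sqr_ge0.
by rewrite lte_add_pinfty// lte_mul_pinfty// lee_fin mulr_ge0// sqr_ge0.
Qed.

End StronglyMeasurable.

Section L2.
Context {R : realType} (X : completeNormedModType R).

Definition L2pred : {pred R -> X} :=
  fun f => `[< strongly_measurable f /\ square_integrable f >].

Lemma L2predP (f : R -> X) :
  reflect (strongly_measurable f /\ square_integrable f) (f \in L2pred).
Proof. exact: asboolP. Qed.

Lemma L2pred_submod_closed : submod_closed L2pred.
Proof.
split.
  apply/L2predP; split.
    exists (fun _ => 0) => [_|t _]; last exact: cvg_cst.
    split.
      apply: (@sub_finite_set _ _ [set 0]); last exact: finite_set1.
      by move=> _ [x _ <-].
    by move=> v; rewrite preimage_cst; case: ifP.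
  rewrite /square_integrable integral0_eq ?ltry// => t _.
  by rewrite normr0 expr0n.
move=> a f g /L2predP[mf lf] /L2predP[mg lg]; apply/L2predP; split.
  exact: strongly_measurable_lin.
exact: square_integrable_lin.
Qed.

HB.instance Definition _ :=
  GRing.isSubmodClosed.Build R (R -> X) L2pred L2pred_submod_closed.

Record L2fun := MkL2fun { L2fun_val :> R -> X ; _ : L2fun_val \in L2pred }.

HB.instance Definition _ := [isSub for L2fun_val].
HB.instance Definition _ := gen_eqMixin L2fun.
HB.instance Definition _ := gen_choiceMixin L2fun.
HB.instance Definition _ := [SubChoice_isSubLmodule of L2fun by <:].

Definition ae_eq_I10 (f g : R -> X) : Prop :=
  {ae (@lebesgue_measure R), forall t, I10 t -> f t = g t}.

#[local] Instance leb_ae_filter :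
  Filter (nbhs (almost_everywhere (@lebesgue_measure R))).
Proof. exact: ae_filter_ringOfSetsType. Qed.

Definition L2equiv (f g : L2fun) : bool := `[< ae_eq_I10 f g >].

Lemma L2equiv_refl : reflexive L2equiv.
Proof. by move=> f; apply/asboolP; apply: aeW. Qed.

Lemma L2equiv_sym : symmetric L2equiv.
Proof.
suff H f g : ae_eq_I10 f g -> ae_eq_I10 g f.
  by move=> f g; apply/asboolP/asboolP; exact: H.
by move=> h; apply: (filterS _ h) => t ht It; rewrite ht.
Qed.

Lemma L2equiv_trans : transitive L2equiv.
Proof.
move=> g f h /asboolP fg /asboolP gh; apply/asboolP.
by apply: (filterS2 _ _ fg gh) => t hf hg It; rewrite hf// hg.
Qed.

Canonical L2equiv_equiv :=
  EquivRel L2equiv L2equiv_refl L2equiv_sym L2equiv_trans.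

Local Open Scope quotient_scope.

Definition L2 : Type := {eq_quot L2equiv}.
HB.instance Definition _ := Choice.on L2.
HB.instance Definition _ := EqQuotient.on L2.

Definition L2class (f : L2fun) : L2 := \pi f.
Definition L2rep (F : L2) : L2fun := repr F.

Lemma L2class_eq (f g : L2fun) : L2class f = L2class g <-> ae_eq_I10 f g.
Proof.
split=> [/eqquotP/asboolP//|fg].
by apply/eqquotP/asboolP.
Qed.

Lemma L2repK (F : L2) : L2class (L2rep F) = F.
Proof. exact: reprK. Qed.

Lemma L2classK (f : L2fun) : ae_eq_I10 (L2rep (L2class f)) f.
Proof. by apply/L2class_eq; rewrite L2repK. Qed.

Definition L2zero : L2 := L2class 0.
Definition L2add (F G : L2) : L2 := L2class (L2rep F + L2rep G).
Definition L2opp (F : L2) : L2 := L2class (- L2rep F).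
Definition L2scale (a : R) (F : L2) : L2 := L2class (a *: L2rep F).

Lemma L2class_add f g : L2add (L2class f) (L2class g) = L2class (f + g).
Proof.
apply/L2class_eq; apply: (filterS2 _ _ (L2classK f) (L2classK g)) => t hf hg It.
by rewrite /= /GRing.add /= hf// hg.
Qed.

Lemma L2class_opp f : L2opp (L2class f) = L2class (- f).
Proof.
apply/L2class_eq; apply: (filterS _ (L2classK f)) => t hf It.
by rewrite /= /GRing.opp /= hf.
Qed.

Lemma L2class_scale a f : L2scale a (L2class f) = L2class (a *: f).
Proof.
apply/L2class_eq; apply: (filterS _ (L2classK f)) => t hf It.
by rewrite /= /GRing.scale /= hf.
Qed.

Lemma L2addA : associative L2add.
Proof.
move=> F G H; rewrite -(L2repK F) -(L2repK G) -(L2repK H).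
by rewrite !L2class_add addrA.
Qed.

Lemma L2addC : commutative L2add.
Proof.
by move=> F G; rewrite -(L2repK F) -(L2repK G) !L2class_add addrC.
Qed.

Lemma L2add0 : left_id L2zero L2add.
Proof. by move=> F; rewrite -(L2repK F) L2class_add add0r. Qed.

Lemma L2addN : left_inverse L2zero L2opp L2add.
Proof.
by move=> F; rewrite -(L2repK F) L2class_opp L2class_add addNr.
Qed.

HB.instance Definition _ :=
  GRing.isZmodule.Build L2 L2addA L2addC L2add0 L2addN.

Lemma L2scaleA a b F : L2scale a (L2scale b F) = L2scale (a * b) F.
Proof. by rewrite -(L2repK F) !L2class_scale scalerA. Qed.

Lemma L2scale1 : left_id 1 L2scale.
Proof. by move=> F; rewrite -(L2repK F) L2class_scale scale1r. Qed.

Lemma L2scaleDr : right_distributive L2scale +%R.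
Proof.
move=> a F G; rewrite -(L2repK F) -(L2repK G) /GRing.add /=.
by rewrite !(L2class_add, L2class_scale) scalerDr.
Qed.

Lemma L2scaleDl F : {morph L2scale^~ F : a b / a + b}.
Proof.
move=> a b; rewrite -(L2repK F) /GRing.add /=.
by rewrite !(L2class_add, L2class_scale) scalerDl.
Qed.

HB.instance Definition _ :=
  GRing.Zmodule_isLmodule.Build R L2 L2scaleA L2scale1 L2scaleDr L2scaleDl.

End L2.

Section Sobolev.
Context {R : realType} {X : completeNormedModType R}.

Definition simple_integral (s : R -> X) : X :=
  \sum_(v \in range s) fine (leb (I10 `&` s @^-1` [set v])) *: v.

Definition is_Bochner_integral (f : R -> X) (I : X) : Prop :=
  exists s : nat -> R -> X,
    [/\ forall n, simple_fun (s n),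
        (\int[leb]_(t in I10) (`|f t - s n t|)%:E @[n --> \oo] --> 0)%E
      & simple_integral (s n) @[n --> \oo] --> I].

(* The test functions are the elements of C_c^oo(]-1, 0[). *)
Definition test_function (phi : R -> R) : Prop :=
  (forall n t, derivable (derive1n n phi) t 1) /\
  exists a b : R, [/\ -1 < a, b < 0 & forall t, ~~ (a <= t <= b) -> phi t = 0].

Definition is_weak_derivative (f g : R -> X) : Prop :=
  forall phi, test_function phi -> exists2 I : X,
    is_Bochner_integral (fun t => derive1 phi t *: f t) I &
    is_Bochner_integral (fun t => phi t *: g t) (- I).

Definition W12 : set (L2 X) :=
  [set F | exists G : L2 X, is_weak_derivative (L2rep F) (L2rep G)].

Definition weak_derivative (F : L2 X) : L2 X :=
  xget 0 [set G | is_weak_derivative (L2rep F) (L2rep G)].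

(* Unique on I10, and its values outside I10 are never used. *)
Definition continuous_rep (F : L2 X) : R -> X :=
  xget (fun=> 0) [set f | {within I10, continuous f} /\ ae_eq_I10 f (L2rep F)].

End Sobolev.

Section Delay.
Context {R : realType} {X : completeNormedModType R}.
Variables (B : operator X) (zeta : R -> X -> X).

Definition delay_Phi (F : L2 X) : X :=
  RS_integral_op zeta (continuous_rep F) (-1) 0.

Definition delay_operator : operator (X * L2 X)%type :=
  Operator
    [set u | [/\ op_dom B u.1, W12 u.2 & continuous_rep u.2 0 = u.1]]
    (fun u => (op_fun B u.1 + delay_Phi u.2, weak_derivative u.2)).

End Delay.

Section ProductInnerProducts.
Context {R : realType} {X : completeNormedModType R}.
Variable ip : X -> X -> R.

Definition canonical_ip (u v : X * L2 X) : R :=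
  ip u.1 v.1 + \int[leb]_(s in I10) ip (L2rep u.2 s) (L2rep v.2 s).

Definition weighted_ip (tau : R -> R) (u v : X * L2 X) : R :=
  ip u.1 v.1 + \int[leb]_(s in I10) (tau s * ip (L2rep u.2 s) (L2rep v.2 s)).

(* The integral is finite, and its value is that for any representatives. *)
Definition weighted_ip_well_defined (tau : R -> R) : Prop :=
  forall (c d : X) (f g : L2fun X),
    leb.-integrable I10 (fun s => (tau s * ip (f s) (g s))%:E) /\
    weighted_ip tau (c, L2class f) (d, L2class g) =
      ip c d + \int[leb]_(s in I10) (tau s * ip (f s) (g s)).

End ProductInnerProducts.

Section Weight.
Context {R : realType} {X : completeNormedModType R}.
Variable zeta : R -> X -> X.

Definition tv (t : R) : R := op_total_variation zeta (-1) t.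

Definition exp_tv_integral (mu t : R) : R :=
  RS_integral_real tv (fun r => expR (2 * mu * r)) t 0.

Definition delay_weight (lambda mu t : R) : R :=
  expR (- (2 * mu * t)) *
  (mu - lambda - (tv 0 - tv (-1)) / (mu - lambda) * exp_tv_integral mu t).

End Weight.

(* Main.v *)
(* With [m := mu - lambda], [V] the total variation of [zeta] and [u t := |f t|^2],
   the weight solves, in the sense of Stieltjes measures,
   [d tau = - 2 mu tau dt + (V / m) d|zeta|]. Integrating [2 tau <f', f> = tau u']
   by parts therefore leaves, besides the boundary terms and [2 mu] times the
   integral of [tau u], the term [- (V / m) J] with [J] the integral of [u d|zeta|].
   By Cauchy-Schwarz [|Phi f|^2 <= V J], so [<Phi f, x>] is at most
   [m |x|^2 / 2 + V J / (2 m)] and the terms cancel, using [tau 0 = m] and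
   [0 <= tau (-1)].

   Every Stieltjes integral involved has an absolutely continuous integrand, and
   reduces by parts to a Lebesgue integral. The continuous representative of a
   Sobolev function is obtained from Lebesgue's differentiation theorem applied to
   its inner products with countably many vectors. *)

Require Import Defs.
From mathcomp Require Import all_boot all_order all_algebra finmap.
From mathcomp Require Import all_classical all_reals all_analysis.
From mathcomp Require Import measurable_realfun ring lra.

Set Implicit Arguments.
Unset Strict Implicit.
Unset Printing Implicit Defensive.

Import Order.TTheory GRing.Theory Num.Theory.
Import numFieldNormedType.Exports.

Local Open Scope classical_set_scope.
Local Open Scope ring_scope.

(** * Absolutely continuous functions on [-1, 0] *)

(** The jumps of the total variation shape the proof: neither [tv] nor the weight can be
    differentiated, so every integration by parts puts the derivative on an absolutely continuous
    factor. Such factors are handled through integral identities for their increments, never through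
    pointwise derivatives. X need not be separable, and weak derivatives are defined by Bochner
    integrals, so vector identities become scalar ones by pairing with a fixed vector. The
    exceptional null set depends on that vector; hence the restriction to countably many, which
    strong measurability supplies. The fundamental theorem is thus obtained only against the values
    of the representative, which suffices because the estimate sees f only through |f|^2. The
    constants come from a budget: B - mu contributes - m |x|^2, one half of which pays for the
    boundary term of the weight at 0 and the other half for Young's inequality applied to the delay
    term. The condition on mu says that the bracket in the weight is positive at -1, where it is
    smallest. *)

Section ScalarCalculus.
Context {R : realType}.
Local Notation leb := (@lebesgue_measure R).
Implicit Types f g h u v : R -> R.

Lemma I10E (x : R) : I10 x = (-1 <= x <= 0) :> Prop.
Proof. by rewrite /I10 /= in_itv. Qed.

Lemma sub_itvoc_I10 (s t : R) : -1 <= s -> t <= 0 -> `]s, t]%classic `<=` I10.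
Proof.
move=> s1 t0 x /=; rewrite in_itv /= => /andP[sx xt]; rewrite I10E.
by rewrite (le_trans s1 (ltW sx)) (le_trans xt t0).
Qed.

Lemma lebesgue_I10_lty : (leb (I10 : set R) < +oo)%E.
Proof. by rewrite /I10 lebesgue_measure_itv /= lte_fin ltrN10 ltry. Qed.

Lemma integrable_itvoc g (s t : R) : -1 <= s -> t <= 0 ->
  leb.-integrable I10 (EFin \o g) -> leb.-integrable `]s, t] (EFin \o g).
Proof.
move=> s1 t0; apply: integrableS => //; first exact: measurable_I10.
exact: sub_itvoc_I10.
Qed.

Lemma integrable_I10_measurable g : leb.-integrable I10 (EFin \o g) ->
  measurable_fun (I10 : set (measurableTypeR R)) g.
Proof. by move=> ig; apply/measurable_EFinP; exact: measurable_int ig. Qed.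

Lemma bounded_integrable_I10 g (M : R) :
  measurable_fun (I10 : set (measurableTypeR R)) g ->
  (forall x, I10 x -> `|g x| <= M) -> leb.-integrable I10 (EFin \o g).
Proof.
move=> mg gM; apply: measurable_bounded_integrable => //.
- exact: measurable_I10.
- exact: lebesgue_I10_lty.
- exists M; split; first exact: num_real.
  by move=> y My x Ix /=; apply: le_trans (gM x Ix) (ltW My).
Qed.

Lemma bounded_mul_integrable_I10 h g (M : R) :
  measurable_fun (I10 : set (measurableTypeR R)) h ->
  (forall x, I10 x -> `|h x| <= M) -> leb.-integrable I10 (EFin \o g) ->
  leb.-integrable I10 (EFin \o (fun x => h x * g x)).
Proof.
move=> mh hM ig.
suff : leb.-integrable I10 ((EFin \o h) \* (EFin \o g))%E.
  by apply: eq_integrable => //; exact: measurable_I10.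
apply: integrableMr => //; first exact: measurable_I10.
exists M; split; first exact: num_real.
by move=> y My x Ix /=; apply: le_trans (hM x Ix) (ltW My).
Qed.

Lemma integrable_add (D : set R) f g : measurable D ->
  leb.-integrable D (EFin \o f) -> leb.-integrable D (EFin \o g) ->
  leb.-integrable D (EFin \o (fun x => f x + g x)).
Proof. by move=> mD fi gi; apply: (integrableD _ fi gi). Qed.

Lemma integrable_sub (D : set R) f g : measurable D ->
  leb.-integrable D (EFin \o f) -> leb.-integrable D (EFin \o g) ->
  leb.-integrable D (EFin \o (fun x => f x - g x)).
Proof. by move=> mD fi gi; apply: (integrableB _ fi gi). Qed.

Lemma integrable_scale (D : set R) (a : R) f : measurable D ->
  leb.-integrable D (EFin \o f) ->
  leb.-integrable D (EFin \o (fun x => a * f x)).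
Proof. by move=> mD fi; have := @integrableZl _ _ _ leb D mD a (EFin \o f) fi. Qed.

Lemma integrable_normr (D : set R) f : measurable D ->
  leb.-integrable D (EFin \o f) ->
  leb.-integrable D (EFin \o (fun x => `|f x|)).
Proof. by move=> mD fi; apply: (integrable_norm fi). Qed.

Lemma Rintegral_itvoc_cat g (s m t : R) : -1 <= s -> s <= m -> m <= t ->
  t <= 0 -> leb.-integrable I10 (EFin \o g) ->
  \int[leb]_(x in `]s, t]) g x =
  \int[leb]_(x in `]s, m]) g x + \int[leb]_(x in `]m, t]) g x.
Proof.
move=> s1 sm mt t0 ig.
have := @Rintegral_itvB R g (BRight s) (BRight t) m.
move=> /(_ (integrable_itvoc s1 t0 ig)) <-; rewrite ?bnd_simp//.
by rewrite addrC subrK.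
Qed.

Lemma Rintegral_I10_itvoc g : leb.-integrable I10 (EFin \o g) ->
  \int[leb]_(x in I10) g x = \int[leb]_(x in `](-1), 0]) g x.
Proof.
move=> ig; rewrite /I10 -Rintegral_itv_obnd_cbnd//.
by apply: integrable_itvoc.
Qed.

Lemma Rintegral_itvoc_small g : leb.-integrable I10 (EFin \o g) ->
  forall e : R, 0 < e -> exists2 d : R, 0 < d & forall s t, -1 <= s -> s <= t ->
    t <= 0 -> t - s < d -> \int[leb]_(x in `]s, t]) `|g x| < e.
Proof.
move=> ig e e0.
have : leb.-integrable setT (EFin \o g \_ I10).
  rewrite -restrict_EFin; apply/integrable_restrict => //=.
    exact: measurable_I10.
  by rewrite setTI.
move=> /integral_normr_continuous /(_ _ e0)[d [d0 gd]].
exists d => // s t s1 st t0 tsd.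
have /gd : (leb `]s, t] < d%:E)%E.
  rewrite lebesgue_measure_itv /= lte_fin; case: ifPn => _; last by rewrite lte_fin.
  by rewrite -EFinD lte_fin.
move=> /(_ (measurable_itv _)); congr (_ < _).
apply: eq_Rintegral => x; rewrite inE => xst; rewrite patchT// inE.
exact: sub_itvoc_I10 xst.
Qed.

(* [D] is Lipschitz with respect to [M] with a constant that tends to 0 with the
   step, so summing over fine uniform subdivisions gives [D t = D s]. *)
Lemma small_increments_constant (D M : R -> R) :
  (forall e : R, 0 < e -> exists2 d : R, 0 < d & forall s t, -1 <= s -> s <= t ->
    t <= 0 -> t - s < d -> `|D t - D s| <= e * (M t - M s)) ->
  forall s t, -1 <= s -> s <= t -> t <= 0 -> D t = D s.
Proof.
move=> DM s t s1 st t0.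
apply/eqP; rewrite -subr_eq0 -normr_eq0 eq_le normr_ge0 andbT.
apply/ler_addgt0Pl => e e0; rewrite addr0.
(* The summand 1 keeps the denominator positive when [M t = M s]. *)
pose e' := e / (`|M t - M s| + 1).
have e'0 : 0 < e' by rewrite divr_gt0// ltr_wpDl.
have [d d0 Hd] := DM _ e'0.
have [n nd] : exists n : nat, (t - s) / n.+1%:R < d.
  exists (Num.bound ((t - s) / d)).
  rewrite ltr_pdivrMr// mulrC -ltr_pdivrMr//.
  have td : 0 <= (t - s) / d by rewrite divr_ge0 ?subr_ge0// ltW.
  by rewrite (lt_trans (archi_boundP td))// ltr_nat.
pose p (i : nat) := s + (t - s) * (i%:R / n.+1%:R).
have p0 : p 0%N = s by rewrite /p mul0r mulr0 addr0.
have pn : p n.+1 = t by rewrite /p divff// mulr1 addrC subrK.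
have pS i : p i.+1 - p i = (t - s) / n.+1%:R.
  rewrite /p opprD addrACA subrr add0r -mulrBr -mulrBl.
  by rewrite -natrB// subSnn mul1r.
have pm i j : (i <= j)%N -> p i <= p j.
  by move=> ij; rewrite /p lerD2l ler_wpM2l ?subr_ge0// ler_pM2r// ler_nat.
have -> : D t - D s = \sum_(0 <= i < n.+1) (D (p i.+1) - D (p i)).
  by rewrite (telescope_sumr (fun i => D (p i)))// p0 pn.
apply: (le_trans (ler_norm_sum _ _ _)).
have le1 : \sum_(0 <= i < n.+1) `|D (p i.+1) - D (p i)| <=
    \sum_(0 <= i < n.+1) e' * (M (p i.+1) - M (p i)).
  rewrite !big_mkord; apply: ler_sum => i _; apply: Hd.
  - by rewrite (le_trans s1)// -p0 pm.
  - exact: pm.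
  - by rewrite (le_trans _ t0)// -pn pm.
  - by rewrite pS.
apply: (le_trans le1); rewrite -mulr_sumr.
rewrite (telescope_sumr (fun i => M (p i)))// p0 pn.
rewrite /e' mulrAC ler_pdivrMr ?ltr_wpDl//.
rewrite ler_pM2l//; have := ler_norm (M t - M s); lra.
Qed.

(** Absolute continuity with density g. Half-open intervals make increments add up exactly under
    concatenation. *)
Definition primitive_of (u g : R -> R) : Prop :=
  leb.-integrable I10 (EFin \o g) /\
  forall s t : R, -1 <= s -> s <= t -> t <= 0 ->
    u t - u s = \int[leb]_(x in `]s, t]) g x.

Lemma primitive_of_norm_le u g : primitive_of u g ->
  forall s t : R, -1 <= s -> s <= t -> t <= 0 ->
    `|u t - u s| <= \int[leb]_(x in `]s, t]) `|g x|.
Proof.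
move=> [ig ug] s t s1 st t0; rewrite ug//.
by apply: le_normr_Rintegral => //; exact: integrable_itvoc.
Qed.

Lemma Rintegral_itvoc_mono g (s a b t : R) : -1 <= s -> s <= a -> a <= b ->
  b <= t -> t <= 0 -> leb.-integrable I10 (EFin \o g) -> (forall x, 0 <= g x) ->
  \int[leb]_(x in `]a, b]) g x <= \int[leb]_(x in `]s, t]) g x.
Proof.
move=> s1 sa ab bt t0 ig g0.
rewrite (@Rintegral_itvoc_cat _ s a)//; last exact: le_trans bt.
rewrite (@Rintegral_itvoc_cat _ a b t)//; last exact: le_trans s1 sa.
rewrite addrCA lerDl addr_ge0// Rintegral_ge0//.
Qed.

(** Uniform continuity, phrased as oscillation over a short interval: this is the form needed for a
    Riemann-Stieltjes cell with an arbitrary tag and for second-order estimates. *)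
Lemma primitive_of_osc u g : primitive_of u g ->
  forall e : R, 0 < e -> exists2 d : R, 0 < d & forall s t, -1 <= s -> s <= t ->
    t <= 0 -> t - s < d -> forall x y, s <= x -> x <= t -> s <= y -> y <= t ->
    `|u x - u y| <= e.
Proof.
move=> ug e e0; have [ig _] := ug.
have [d d0 gd] := Rintegral_itvoc_small ig e0.
exists d => // s t s1 st t0 tsd x y sx xt sy yt.
wlog yx : x y sx xt sy yt / y <= x.
  move=> H; case: (leP y x) => [|/ltW] xy; first exact: H.
  by rewrite distrC; exact: H.
apply: (le_trans (primitive_of_norm_le ug _ yx _)).
- exact: le_trans sy.
- exact: le_trans t0.
apply: le_trans (ltW (gd s t s1 st t0 tsd)).
apply: Rintegral_itvoc_mono => //.
by apply: integrable_normr => //; exact: measurable_I10.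
Qed.

Lemma primitive_of_within_continuous u g : primitive_of u g ->
  {within I10, continuous u}.
Proof.
move=> ug; apply/subspace_continuousP => x.
rewrite I10E => /andP[x1 x0]; apply/cvgrPdist_le => e e0.
have [d d0 H] := primitive_of_osc ug e0.
near=> y.
have : I10 y by near: y; exact: withinT.
rewrite I10E => /andP[y1 y0].
have xyd : `|x - y| < d.
  near: y; apply: cvg_within; apply/nbhs_ballP; exists d => //= z.
case: (leP x y) => xy.
- apply: (H x y) => //; move: xyd.
  by rewrite distrC ger0_norm// subr_ge0.
- have xy' := ltW xy.
  apply: (H y x) => //; move: xyd.
  by rewrite ger0_norm// subr_ge0.
Unshelve. all: by end_near. Qed.

Lemma primitive_of_measurable u g : primitive_of u g ->
  measurable_fun (I10 : set (measurableTypeR R)) u.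
Proof.
move=> /primitive_of_within_continuous uc.
by apply: subspace_continuous_measurable_fun => //; exact: measurable_I10.
Qed.

Lemma primitive_of_bounded u g : primitive_of u g ->
  exists M : R, forall x, I10 x -> `|u x| <= M.
Proof.
move=> ug; have [ig _] := ug.
exists (`|u (-1)| + \int[leb]_(x in `](-1), 0]) `|g x|) => x.
rewrite I10E => /andP[x1 x0].
have -> : u x = u (-1) + (u x - u (-1)) by rewrite addrC subrK.
apply: (le_trans (ler_normD _ _)); rewrite lerD2l.
apply: (le_trans (primitive_of_norm_le ug _ _ _)) => //.
apply: Rintegral_itvoc_mono => //.
by apply: integrable_normr => //; exact: measurable_I10.
Qed.

Lemma primitive_of_mul_integrable u g f : primitive_of u g ->
  leb.-integrable I10 (EFin \o f) ->
  leb.-integrable I10 (EFin \o (fun x => u x * f x)).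
Proof.
move=> ug fi; have [M uM] := primitive_of_bounded ug.
by apply: (bounded_mul_integrable_I10 (primitive_of_measurable ug) uM).
Qed.

(* The product of the increments is of second order, so the defect of the
   product rule has increments controlled by [small_increments_constant]. *)
Lemma primitive_of_mul u g v h : primitive_of u g -> primitive_of v h ->
  primitive_of (fun x => u x * v x) (fun x => g x * v x + u x * h x).
Proof.
move=> ug vh; have [ig eu] := ug; have [ih ev] := vh.
have mI : measurable (I10 : set R) := measurable_I10.
have igv : leb.-integrable I10 (EFin \o (fun x => g x * v x)).
  have := primitive_of_mul_integrable vh ig.
  by apply: eq_integrable => // x _ /=; rewrite mulrC.
have iuh := primitive_of_mul_integrable ug ih.
have iF := integrable_add mI igv iuh.
split => // s t s1 st t0.
set F := fun x => g x * v x + u x * h x.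
pose P y := \int[leb]_(x in `](-1), y]) F x.
pose M y := \int[leb]_(x in `](-1), y]) (`|g x| + `|h x|).
have igh : leb.-integrable I10 (EFin \o (fun x => `|g x| + `|h x|)).
  by apply: integrable_add => //; exact: integrable_normr.
have PD a b : -1 <= a -> a <= b -> b <= 0 ->
    P b - P a = \int[leb]_(x in `]a, b]) F x.
  by move=> a1 ab b0; rewrite /P (@Rintegral_itvoc_cat _ _ a b)// addrAC subrr add0r.
have MD a b : -1 <= a -> a <= b -> b <= 0 ->
    M b - M a = \int[leb]_(x in `]a, b]) (`|g x| + `|h x|).
  by move=> a1 ab b0; rewrite /M (@Rintegral_itvoc_cat _ _ a b)// addrAC subrr add0r.
suff : u t * v t - P t = u s * v s - P s.
  by rewrite -PD//; lra.
move: s t s1 st t0; apply: (@small_increments_constant _ M) => e e0.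
have [d1 d10 H1] := primitive_of_osc ug e0.
have [d2 d20 H2] := primitive_of_osc vh e0.
exists (Num.min d1 d2); first by rewrite lt_min d10.
move=> s t s1 st t0; rewrite lt_min => /andP[tsd1 tsd2].
have igs := integrable_itvoc s1 t0 ig.
have ihs := integrable_itvoc s1 t0 ih.
(* Freezing v at the left end and u at the right end makes the discrete product rule exact; only the
   difference with F under the integral remains. *)
have -> : u t * v t - P t - (u s * v s - P s) =
    \int[leb]_(x in `]s, t]) (v s * g x + u t * h x - F x).
  rewrite RintegralB; last 3 first.
  - exact: measurable_itv.
  - by apply: integrable_add => //; exact: integrable_scale.
  - exact: integrable_itvoc.
  rewrite RintegralD ?RintegralZl//=.
  - rewrite -PD// -eu// -ev//; ring.
  - exact: integrable_scale.
  - exact: integrable_scale.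
have iL : leb.-integrable `]s, t] (EFin \o (fun x => v s * g x + u t * h x - F x)).
  apply: integrable_sub => //; last exact: integrable_itvoc.
  by apply: integrable_add => //; exact: integrable_scale.
apply: (le_trans (le_normr_Rintegral _ iL)) => //.
rewrite MD// -RintegralZl//; last exact: integrable_itvoc.
apply: le_Rintegral => //.
- exact: integrable_normr.
- apply: integrable_scale => //; exact: integrable_itvoc.
move=> x /=; rewrite in_itv/= => /andP[/ltW sx xt].
have -> : v s * g x + u t * h x - F x = (v s - v x) * g x + (u t - u x) * h x.
  by rewrite /F; ring.
apply: (le_trans (ler_normD _ _)); rewrite !normrM mulrDr.
by apply: lerD; apply: ler_wpM2r => //; [apply: (H2 s t)|apply: (H1 s t)].
Qed.

Lemma primitive_of_integral g : leb.-integrable I10 (EFin \o g) ->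
  primitive_of (fun t => \int[leb]_(x in `](-1), t]) g x) g.
Proof.
move=> ig; split => //= s t s1 st t0.
by rewrite /= (@Rintegral_itvoc_cat _ _ s t)// addrAC subrr add0r.
Qed.

End ScalarCalculus.

(** * Riemann-Stieltjes integrals *)

Section Partitions.
Context {R : realType}.
Implicit Types (a b : R) (s : seq R).

Lemma node_le a b s (i j : nat) : itv_partition a b s ->
  (i <= j)%N -> (j <= size s)%N -> node a s i <= node a s j.
Proof.
move=> [ps _] ij js.
elim: j ij js => [|j ih].
  by rewrite leqn0 => /eqP ->.
rewrite leq_eqVlt => /predU1P[->//|ij] js.
apply: (le_trans (ih ij (ltnW js))).
by move/(pathP a) : ps => /(_ j js) /ltW.
Qed.

Lemma node_last a b s : itv_partition a b s -> node a s (size s) = b.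
Proof. by move=> [_ /eqP <-]; rewrite /node nth_last. Qed.

Lemma node_ge a b s (i : nat) : itv_partition a b s -> (i <= size s)%N ->
  a <= node a s i.
Proof. by move=> abs si; exact: (node_le abs (leq0n i) si). Qed.

Lemma node_le_last a b s (i : nat) : itv_partition a b s -> (i <= size s)%N ->
  node a s i <= b.
Proof. by move=> abs si; rewrite -(node_last abs) (node_le abs). Qed.

Lemma sum_node_increments (P : R -> R) a b s : itv_partition a b s ->
  \sum_(i < size s) (P (node a s i.+1) - P (node a s i)) = P b - P a.
Proof.
move=> abs.
rewrite -(big_mkord xpredT (fun i => P (node a s i.+1) - P (node a s i))).
by rewrite (telescope_sumr (fun i => P (node a s i)))// (node_last abs).
Qed.

Lemma fine_itv_partition a b (d : R) : a <= b -> 0 < d ->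
  exists s, itv_partition a b s /\
    forall i, (i < size s)%N -> node a s i.+1 - node a s i < d.
Proof.
(* Partitions are strictly increasing, so a one-point interval has only the empty one. *)
rewrite le_eqVlt => /predU1P[->|ab] d0; first by exists [::].
have ba : 0 < b - a by rewrite subr_gt0.
have [n nd] : exists n : nat, (b - a) / n.+1%:R < d.
  exists (Num.bound ((b - a) / d)).
  rewrite ltr_pdivrMr// mulrC -ltr_pdivrMr//.
  have bd : 0 <= (b - a) / d by rewrite divr_ge0// ltW.
  by rewrite (lt_trans (archi_boundP bd))// ltr_nat.
pose p (i : nat) := a + (b - a) * (i%:R / n.+1%:R).
have p0 : p 0%N = a by rewrite /p mul0r mulr0 addr0.
have pn : p n.+1 = b by rewrite /p divff// mulr1 addrC subrK.
have pS i : p i.+1 - p i = (b - a) / n.+1%:R.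
  rewrite /p opprD addrACA subrr add0r -mulrBr -mulrBl.
  by rewrite -natrB// subSnn mul1r.
pose s := mkseq (fun i => p i.+1) n.+1.
have ss : size s = n.+1 by rewrite size_mkseq.
have ns i : (i <= n.+1)%N -> node a s i = p i.
  by case: i => [|i] ni; rewrite ?p0// /node [LHS]/= nth_mkseq.
exists s; split; last first.
  by move=> i; rewrite ss => ni; rewrite !ns// ?pS// ltnW.
split.
  apply/(pathP a) => i; rewrite ss => ni.
  have := ns i.+1 ni; rewrite /node /= => ->.
  by have := ns i (ltnW ni); rewrite /node => ->; rewrite -subr_gt0 pS divr_gt0.
by rewrite -nth_last -[nth _ _ _]/(node a s (size s)) ss ns// pn.
Qed.

End Partitions.

Section RiemannStieltjesUnique.
Context {R : realType} {U : zmodType} {V : Type} {W : normedModType R}.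
Variable op : U -> V -> W.

(** Both values are close to one and the same left-tagged sum. The existence of arbitrarily fine
    partitions is what keeps the definition from holding vacuously. *)
Lemma is_RS_integral_unique (z : R -> U) (f : R -> V) (a b : R) (I J : W) :
  a <= b -> is_RS_integral op z f a b I -> is_RS_integral op z f a b J -> I = J.
Proof.
move=> ab hI hJ; apply/eqP; rewrite -subr_eq0 -normr_eq0 eq_le normr_ge0 andbT.
apply/ler_addgt0Pl => e e0; rewrite addr0.
have e2 : 0 < e / 2 by rewrite divr_gt0.
have [d1 d10 H1] := hI _ e2; have [d2 d20 H2] := hJ _ e2.
have d0 : 0 < Num.min d1 d2 by rewrite lt_min d10.
have [s [abs sd]] := fine_itv_partition ab d0.
have tags i : (i < size s)%N -> node a s i <= node a s i <= node a s i.+1.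
  by move=> si; rewrite lexx (node_le abs).
have {}H1 : `|RS_sum op z f a s (node a s) - I| < e / 2.
  apply: H1 => // i si; split; last exact: tags.
  by have := sd _ si; rewrite lt_min => /andP[].
have {}H2 : `|RS_sum op z f a s (node a s) - J| < e / 2.
  apply: H2 => // i si; split; last exact: tags.
  by have := sd _ si; rewrite lt_min => /andP[].
set S := RS_sum _ _ _ _ _ _ in H1 H2.
rewrite (_ : I - J = (S - J) - (S - I)); last by rewrite opprB [RHS]addrC addrA subrK.
apply: (le_trans (ler_normB _ _)).
by rewrite (splitr e); apply: lerD; exact: ltW.
Qed.

Lemma RS_integralE (z : R -> U) (f : R -> V) (a b : R) (I : W) :
  a <= b -> is_RS_integral op z f a b I -> RS_integral op z f a b = I.
Proof.
move=> ab hI; apply: xget_unique => //= J hJ.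
exact: is_RS_integral_unique hJ hI.
Qed.

End RiemannStieltjesUnique.

Section RealRiemannStieltjes.
Context {R : realType}.
Local Notation leb := (@lebesgue_measure R).
Implicit Types u g v : R -> R.

Definition nondecreasing_I10 v : Prop :=
  forall s t : R, -1 <= s -> s <= t -> t <= 0 -> v s <= v t.

Lemma nondecreasing_I10_measurable v : nondecreasing_I10 v ->
  measurable_fun (I10 : set (measurableTypeR R)) v.
Proof.
move=> vnd.
(* Clamping the argument to [-1, 0] gives a function that is monotone on the whole line. *)
apply: (eq_measurable_fun (fun x : measurableTypeR R => v (Num.max (-1) (Num.min x 0)))).
  move=> x; rewrite inE I10E => /andP[x1 x0].
  by rewrite (min_idPl x0) (max_idPr x1).
apply: nondecreasing_measurable; first exact: measurable_I10.
move=> x y xy; apply: vnd.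
- by rewrite le_max lexx.
- by rewrite ge_max !le_max lexx/= le_min !ge_min lexx xy orbT !orbT.
- by rewrite ge_max ge_min lexx orbT andbT lerN10.
Qed.

Lemma nondecreasing_I10_bounded v : nondecreasing_I10 v ->
  forall x, I10 x -> `|v x| <= `|v (-1)| + `|v 0|.
Proof.
move=> vnd x; rewrite I10E => /andP[x1 x0].
have := vnd _ _ (lexx _) x1 x0; have := vnd _ _ x1 x0 (lexx _).
have := ler_norm (v 0); have := ler_norm (- v (-1)); rewrite normrN.
have := normr_ge0 (v 0); have := normr_ge0 (v (-1)).
by rewrite ler_norml => *; apply/andP; split; lra.
Qed.

Lemma nondecreasing_I10_mul_integrable v g : nondecreasing_I10 v ->
  leb.-integrable I10 (EFin \o g) ->
  leb.-integrable I10 (EFin \o (fun x => v x * g x)).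
Proof.
move=> vnd; apply: (bounded_mul_integrable_I10 (nondecreasing_I10_measurable vnd)).
exact: nondecreasing_I10_bounded.
Qed.

(* Integration by parts: the absolutely continuous function is the one to be
   differentiated, whatever the jumps of the other one. *)
Lemma is_RS_integral_primitive u g v (a b : R) :
  primitive_of u g -> nondecreasing_I10 v -> -1 <= a -> a <= b -> b <= 0 ->
  is_RS_integral (fun dv x : R => x * dv) v u a b
    (u b * v b - u a * v a - \int[leb]_(x in `]a, b]) (v x * g x)).
Proof.
move=> ug vnd a1 ab b0 eps eps0; have [ig ue] := ug.
have W0 : 0 <= v b - v a by rewrite subr_ge0 vnd.
(* A cell [x, y] contributes at most [2 * e * (v y - v x)]: one e for the oscillation of u, one for
   the integral of |g|. The summand 1 makes the final inequality strict. *)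
pose e := eps / (2 * (v b - v a) + 1).
have D0 : 0 < 2 * (v b - v a) + 1 by rewrite ltr_wpDl// mulr_ge0.
have e0 : 0 < e by rewrite divr_gt0.
have ivg := nondecreasing_I10_mul_integrable vnd ig.
have [d1 d10 H1] := primitive_of_osc ug e0.
have [d2 d20 H2] := Rintegral_itvoc_small ig e0.
exists (Num.min d1 d2); first by rewrite lt_min d10.
move=> s xi abs sd.
pose P y := u y * v y - \int[leb]_(x in `](-1), y]) (v x * g x).
have PD x y : -1 <= x -> x <= y -> y <= 0 ->
    P y - P x = u y * v y - u x * v x - \int[leb]_(z in `]x, y]) (v z * g z).
  move=> x1 xy y0; rewrite /P (@Rintegral_itvoc_cat _ _ (-1) x y)//; ring.
rewrite -PD// -(sum_node_increments P abs) /RS_sum -sumrB.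
apply: (le_lt_trans (ler_norm_sum _ _ _)).
apply: (@le_lt_trans _ _ (\sum_(i < size s) (2 * e) *
    (v (node a s i.+1) - v (node a s i)))); last first.
  rewrite -mulr_sumr (sum_node_increments v abs).
  have <- : e * (2 * (v b - v a) + 1) = eps by rewrite divfK// gt_eqF.
  by rewrite (_ : e * _ = 2 * e * (v b - v a) + e) ?ltrDl//; ring.
apply: ler_sum => -[i si] _ /=.
have [+ xii] := sd _ si; rewrite lt_min => /andP[sd1 sd2].
have := node_le abs (leqnSn i) si; have := node_ge abs (ltnW si).
have := node_le_last abs si.
set x := node a s i in sd1 sd2 xii *; set y := node a s i.+1 in sd1 sd2 xii * => yb ax xy.
have x1 : -1 <= x := le_trans a1 ax.
have y0 : y <= 0 := le_trans yb b0.
have vxy : v x <= v y by exact: vnd.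
have igxy := integrable_itvoc x1 y0 ig.
have ivgxy := integrable_itvoc x1 y0 ivg.
rewrite PD//.
(* With the tag moved to the right end y, integration by parts on the cell is exact up to the
   integral of (v z - v x) g z. *)
have -> : u (xi i) * (v y - v x) -
     (u y * v y - u x * v x - \int[leb]_(z in `]x, y]) (v z * g z)) =
   (u (xi i) - u y) * (v y - v x) +
     \int[leb]_(z in `]x, y]) (v z * g z - v x * g z).
  rewrite RintegralB ?RintegralZl//=; last exact: integrable_scale.
  by rewrite -ue//; ring.
apply: (le_trans (ler_normD _ _)).
rewrite (_ : 2 * e * (v y - v x) = e * (v y - v x) + e * (v y - v x)); last by ring.
apply: lerD.
  rewrite normrM (ger0_norm (_ : 0 <= v y - v x)) ?subr_ge0//.
  apply: ler_wpM2r; first by rewrite subr_ge0.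
  by case/andP: xii => xxi xiy; apply: (H1 x y).
have id : leb.-integrable `]x, y] (EFin \o (fun z => v z * g z - v x * g z)).
  by apply: integrable_sub => //; exact: integrable_scale.
apply: (le_trans (le_normr_Rintegral _ id)) => //.
apply: (@le_trans _ _ (\int[leb]_(z in `]x, y]) ((v y - v x) * `|g z|))).
  apply: le_Rintegral => //.
  - exact: integrable_normr.
  - by apply: integrable_scale => //; exact: integrable_normr.
  move=> z /=; rewrite in_itv/= => /andP[/ltW xz zy].
  rewrite -mulrBl normrM; apply: ler_wpM2r => //.
  have vxz : v x <= v z by apply: vnd => //; exact: le_trans y0.
  have vzy : v z <= v y by apply: vnd => //; exact: le_trans xz.
  by rewrite ger0_norm ?subr_ge0// lerB.
rewrite RintegralZl//; last exact: integrable_normr.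
rewrite mulrC; apply: ler_wpM2r; first by rewrite subr_ge0.
exact/ltW/H2.
Qed.

Lemma is_RS_integral_ge0 u v (a b J : R) : nondecreasing_I10 v ->
  -1 <= a -> a <= b -> b <= 0 -> (forall x, 0 <= u x) ->
  is_RS_integral (fun dv x : R => x * dv) v u a b J -> 0 <= J.
Proof.
move=> vnd a1 ab b0 u0 hJ; apply/ler_addgt0Pr => e e0; have [d d0 H] := hJ _ e0.
have [s [abs sd]] := fine_itv_partition ab d0.
have := H s (node a s) abs; set S := RS_sum _ _ _ _ _ _ => HS.
have S0 : 0 <= S.
  apply: sumr_ge0 => -[i si] _ /=; rewrite mulr_ge0 ?u0// subr_ge0.
  apply: vnd.
  - exact: le_trans a1 (node_ge abs (ltnW si)).
  - exact: node_le abs (leqnSn i) si.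
  - exact: le_trans (node_le_last abs si) b0.
have : `|S - J| < e.
  apply: HS => i si; split; first exact: sd.
  by rewrite lexx (node_le abs).
by rewrite distrC => /ltW; rewrite ler_norml => /andP[h _]; lra.
Qed.

End RealRiemannStieltjes.

(** * Total variation of operator-valued functions *)

Section OperatorVariation.
Context {R : realType} {X : completeNormedModType R}.
Implicit Type T : X -> X.

Lemma op_norm_ubP T (M : R) : (forall x, `|T x| <= M * `|x|) ->
  has_sup [set `|T x| | x in [set x | `|x| <= 1]].
Proof.
move=> TM; split; first by exists `|T 0|; exists 0 => //=; rewrite normr0 ler01.
exists `|M| => _ [x /= x1 <-].
apply: (le_trans (TM x)); apply: (le_trans (ler_norm _)).
by rewrite normrM normr_id ler_piMr.
Qed.

(** Variations involve differences of plain functions, which carry no linear structure; T is a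
    linear copy of S that supplies homogeneity. *)
Lemma op_norm_le (T : {linear X -> X}) (S : X -> X) : S =1 T -> bounded_op S ->
  forall x, `|S x| <= op_norm S * `|x|.
Proof.
move=> ST [M SM] x; have [->|x0] := eqVneq x 0.
  by rewrite ST linear0 !normr0 mulr0.
have nx : 0 < `|x| by rewrite normr_gt0.
rewrite -ler_pdivrMr//.
have -> : `|S x| / `|x| = `|S (`|x|^-1 *: x)|.
  by rewrite !ST linearZ /= normrZ normfV normr_id mulrC.
apply: sup_upper_bound; first exact: op_norm_ubP SM.
exists (`|x|^-1 *: x) => //=.
by rewrite normrZ normfV normr_id mulVf ?gt_eqF.
Qed.

Lemma op_norm_ge0 T : 0 <= op_norm T.
Proof.
rewrite /op_norm; set E := [set _ | _ in _].
(* For an unbounded T there is no supremum and [sup] takes the default value 0. *)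
have [hE|hE] := pselect (has_sup E); last by rewrite sup_out.
apply: (le_trans (normr_ge0 (T 0))); apply: sup_upper_bound => //.
by exists 0 => //=; rewrite normr0 ler01.
Qed.

Variable zeta : R -> {linear X -> X}.
Hypothesis hzeta : forall t, I10 t -> bounded_op (zeta t).
Hypothesis hzeta_bv : op_bounded_variation zeta (-1) 0.

Lemma op_norm_sub_le (s t : R) x : I10 s -> I10 t ->
  `|zeta t x - zeta s x| <= op_norm ((zeta t : X -> X) - (zeta s : X -> X)) * `|x|.
Proof.
move=> Is It.
apply: (@op_norm_le (zeta t \- zeta s) ((zeta t : X -> X) - (zeta s : X -> X))) => //.
have [M1 h1] := hzeta It; have [M2 h2] := hzeta Is.
exists (M1 + M2) => y; rewrite mulrDl.
by apply: (le_trans (ler_normB _ _)); exact: lerD.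
Qed.

Lemma op_variation_rcons (z : R -> X -> X) (a : R) (s : seq R) (t : R) :
  op_variation z a (rcons s t) =
  op_variation z a s + op_norm (z t - z (last a s)).
Proof.
rewrite /op_variation size_rcons big_ord_recr /=; congr (_ + _).
  apply: eq_bigr => -[i si] _ /=; congr (op_norm (z _ - z _)).
    by rewrite /node /= nth_rcons si.
  rewrite /node -rcons_cons nth_rcons /= ltnS ltnW//.
rewrite /node /= nth_rcons ltnn eqxx -rcons_cons nth_rcons /= ltnSn.
by rewrite -last_nth.
Qed.

Lemma itv_partition_rcons (a b t : R) (s : seq R) : itv_partition a b s ->
  b < t -> itv_partition a t (rcons s t).
Proof.
move=> [ps /eqP sb] bt; split; last by rewrite last_rcons.
by rewrite rcons_path ps sb.
Qed.

(** Appending t to a partition of [-1, s]. With t = 0 it bounds all variations by the one on the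
    whole interval; in general it compares the increments of [tv] with those of [zeta]. *)
Lemma op_variations_step (s t : R) x : s < t -> op_variations zeta (-1) s x ->
  op_variations zeta (-1) t (x + op_norm ((zeta t : X -> X) - (zeta s : X -> X))).
Proof.
move=> st [p ps <-]; exists (rcons p t); first exact: itv_partition_rcons ps st.
by rewrite op_variation_rcons; case: ps => _ /eqP ->.
Qed.

Lemma op_variations_nonempty (t : R) : -1 <= t ->
  op_variations zeta (-1) t !=set0.
Proof.
rewrite le_eqVlt => /predU1P[<-|t1].
  by exists (op_variation zeta (-1) [::]); exists [::].
exists (op_variation zeta (-1) [:: t]); exists [:: t] => //.
exact: itv_partition1.
Qed.

Lemma op_variations_has_sup (t : R) : I10 t ->
  has_sup (op_variations zeta (-1) t).
Proof.
rewrite I10E => /andP[t1 t0]; split; first exact: op_variations_nonempty.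
have [M hM] := hzeta_bv.
move: t0; rewrite le_eqVlt => /predU1P[->|t0]; first by exists M.
exists M => x /(op_variations_step t0) /hM; apply: le_trans.
by rewrite lerDl op_norm_ge0.
Qed.

Lemma op_norm_le_tv (s t : R) : -1 <= s -> s <= t -> t <= 0 ->
  op_norm ((zeta t : X -> X) - (zeta s : X -> X)) <= tv zeta t - tv zeta s.
Proof.
move=> s1 st t0.
have It : I10 t by rewrite I10E t0 (le_trans s1 st).
have Is : I10 s by rewrite I10E s1 (le_trans st t0).
(* A strictly increasing partition cannot repeat a point, so s = t is treated directly: the operator
   norm of the zero map is at most 0. *)
move: st; rewrite le_eqVlt => /predU1P[->|st].
  rewrite !subrr /op_norm.
  apply: ge_sup; first by exists `|0 : X|; exists 0 => //=; rewrite normr0 ler01.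
  by move=> _ [x _ <-]; rewrite normr0.
rewrite lerBrDr addrC -lerBrDr; apply: ge_sup; first exact: op_variations_nonempty.
move=> x /(op_variations_step st) xt; rewrite lerBrDr.
by apply: sup_upper_bound => //; exact: op_variations_has_sup.
Qed.

Lemma tv_nondecreasing : nondecreasing_I10 (tv zeta).
Proof.
move=> s t s1 st t0; rewrite -subr_ge0.
by apply: le_trans (op_norm_le_tv s1 st t0); exact: op_norm_ge0.
Qed.

(** The sum of (a i - r)^2 w i is nonnegative, and the best choice is the weighted mean r = A / W.
    If W vanishes then so does every weight. *)
Lemma sum_cauchy_schwarz (n : nat) (a w : 'I_n -> R) :
  (forall i, 0 <= w i) ->
  (\sum_(i < n) a i * w i) ^+ 2 <= (\sum_(i < n) w i) * \sum_(i < n) a i ^+ 2 * w i.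
Proof.
move=> w0.
set A := \sum_(i < n) a i * w i; set W := \sum_(i < n) w i.
set Q := \sum_(i < n) a i ^+ 2 * w i.
have W0 : 0 <= W by exact: sumr_ge0.
have key r : 0 <= Q - 2 * r * A + r ^+ 2 * W.
  have -> : Q - 2 * r * A + r ^+ 2 * W = \sum_(i < n) (a i - r) ^+ 2 * w i.
    rewrite /Q /A /W !mulr_sumr -sumrB -big_split /=.
    by apply: eq_bigr => i _; ring.
  by apply: sumr_ge0 => i _; rewrite mulr_ge0// sqr_ge0.
move: W0; rewrite le_eqVlt => /predU1P[W0|W0].
  suff -> : A = 0 by rewrite expr0n -W0 mul0r.
  apply: big1 => i _; have : w i == 0.
    have /eqP := esym W0; rewrite psumr_eq0// => /allP /(_ i).
    by rewrite mem_index_enum => /(_ isT).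
  by move=> /eqP ->; rewrite mulr0.
have := key (A / W).
have -> : Q - 2 * (A / W) * A + (A / W) ^+ 2 * W = Q - A ^+ 2 / W.
  by field; rewrite gt_eqF.
by rewrite subr_ge0 ler_pdivrMr// mulrC.
Qed.

(* If the operator-valued integral does not exist, its junk value is 0. *)
Lemma RS_integral_op_sqr_le (f : R -> X) (J : R) :
  is_RS_integral (fun dv x : R => x * dv) (tv zeta) (fun t => `|f t| ^+ 2) (-1) 0 J ->
  `|RS_integral_op zeta f (-1) 0| ^+ 2 <= (tv zeta 0 - tv zeta (-1)) * J.
Proof.
move=> hJ; rewrite /RS_integral_op /RS_integral.
have N10 : (-1 : R) <= 0 by rewrite lerN10.
have V0 : 0 <= tv zeta 0 - tv zeta (-1) by rewrite subr_ge0 tv_nondecreasing.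
set V := tv zeta 0 - _ in V0 *.
case: xgetP => [I _ /= hI|_]; last first.
  rewrite normr0 expr0n /=; apply: mulr_ge0 => //.
  apply: (is_RS_integral_ge0 tv_nondecreasing (lexx _) N10 (lexx _) _ hJ) => t.
  exact: sqr_ge0.
have sqrt_cont : forall e : R, 0 < e -> `|I| ^+ 2 <= V * J + e.
  move=> e e0.
  (* If the two sums are within d0 <= 1 of their limits, passing from |SI|^2 to |I|^2 costs at most
     2 (|I| + 1) d0, and passing from V SJ to V J at most V d0. *)
  pose C := 2 * (`|I| + 1) + V.
  have C0 : 0 < C by rewrite /C; have := normr_ge0 I; lra.
  pose d0 := Num.min 1 (e / C).
  have d0_gt0 : 0 < d0 by rewrite lt_min ltr01 divr_gt0.
  have [d1 d10 H1] := hI _ d0_gt0; have [d2 d20 H2] := hJ _ d0_gt0.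
  have dm : 0 < Num.min d1 d2 by rewrite lt_min d10.
  have [s [abs sd]] := fine_itv_partition N10 dm.
  have tags i : (i < size s)%N ->
      node (-1) s i <= node (-1) s i <= node (-1) s i.+1.
    by move=> si; rewrite lexx (node_le abs).
  have := H1 s (node (-1) s) abs; have := H2 s (node (-1) s) abs.
  set SJ := RS_sum _ _ _ _ _ _; set SI := RS_sum _ _ _ _ _ _.
  move=> {}H2 {}H1.
  have {}H1 : `|SI - I| < d0.
    apply: H1 => i si; split; last exact: tags.
    by have := sd _ si; rewrite lt_min => /andP[].
  have {}H2 : `|SJ - J| < d0.
    apply: H2 => i si; split; last exact: tags.
    by have := sd _ si; rewrite lt_min => /andP[].
  have SIJ : `|SI| ^+ 2 <= V * SJ.
    pose w (i : 'I_(size s)) := tv zeta (node (-1) s i.+1) - tv zeta (node (-1) s i).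
    have w0 i : 0 <= w i.
      rewrite subr_ge0; apply: tv_nondecreasing.
      - exact: node_ge abs (ltnW (ltn_ord i)).
      - exact: node_le abs (leqnSn i) (ltn_ord i).
      - exact: node_le_last abs (ltn_ord i).
    apply: (@le_trans _ _ ((\sum_(i < size s) `|f (node (-1) s i)| * w i) ^+ 2)).
      rewrite lerXn2r// ?nnegrE//; first by apply: sumr_ge0 => i _; rewrite mulr_ge0.
      apply: (le_trans (ler_norm_sum _ _ _)); apply: ler_sum => i _.
      have n1 := node_ge abs (ltnW (ltn_ord i)).
      have n2 := node_le abs (leqnSn i) (ltn_ord i).
      have n3 := node_le_last abs (ltn_ord i).
      apply: (le_trans (op_norm_sub_le _ _ _)).
      - by rewrite I10E n1 (le_trans n2 n3).
      - by rewrite I10E (le_trans n1 n2).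
      by rewrite mulrC; apply: ler_wpM2l => //; exact: op_norm_le_tv.
    apply: (le_trans (sum_cauchy_schwarz _ w0)).
    by rewrite (sum_node_increments (tv zeta) abs).
  have d0C : d0 * C <= e by rewrite -ler_pdivlMr// ge_min lexx orbT.
  have d01 : d0 <= 1 by rewrite ge_min lexx.
  have hI1 : `|I| <= `|SI| + d0.
    have := ler_normD (I - SI) SI; rewrite subrK distrC; move: H1; lra.
  have hI2 : `|SI| <= `|I| + d0.
    have := ler_normD (SI - I) I; rewrite subrK; move: H1; lra.
  have hJ' : SJ <= J + d0.
    by move: H2; rewrite ltr_norml => /andP[_ h]; lra.
  have : V * SJ <= V * (J + d0) by exact: ler_wpM2l.
  have := normr_ge0 SI; have := normr_ge0 I.
  move: SIJ d0C; rewrite /C; nra.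
by apply/ler_addgt0Pr.
Qed.

End OperatorVariation.

(** * The weight *)

Section Exponential.
Context {R : realType}.
Local Notation leb := (@lebesgue_measure R).

Lemma is_derive_expRZ (c x : R) :
  is_derive x 1 (fun t : R => expR (c * t)) (c * expR (c * x)).
Proof.
have H : is_derive x 1 (fun t : R => c * t) c.
  by have := @is_deriveZ _ _ _ id c x 1 1 (is_derive_id x 1); rewrite /GRing.scale /= mulr1.
have := @is_derive1_comp _ (@expR R) (fun t => c * t) x _ _ (is_derive_expR _) H.
by rewrite mulrC.
Qed.

Lemma continuous_expRZ (c : R) : continuous (fun t : R => expR (c * t)).
Proof.
move=> x; apply/differentiable_continuous/derivable1_diffP.
by case: (is_derive_expRZ c x).
Qed.

Lemma primitive_of_expRZ (c : R) :
  primitive_of (fun t => expR (c * t)) (fun t => c * expR (c * t)).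
Proof.
have cc : continuous (fun t : R => c * expR (c * t)).
  by move=> x; apply: cvgMr; exact: continuous_expRZ.
split.
  apply: continuous_compact_integrable; first exact: segment_compact.
  exact: continuous_subspaceT.
move=> s t s1 st t0.
move: st; rewrite le_eqVlt => /predU1P[->|st].
  by rewrite subrr set_itv_ge ?bnd_simp ?ltxx// Rintegral_set0.
rewrite Rintegral_itv_obnd_cbnd; last first.
  have : leb.-integrable `[s, t] (EFin \o (fun t => c * expR (c * t))).
    apply: continuous_compact_integrable; first exact: segment_compact.
    exact: continuous_subspaceT.
  by apply: integrableS => //; exact: subset_itv_oc_cc.
rewrite /Rintegral (@continuous_FTC2 _ _ (fun t => expR (c * t)))//.
- exact: continuous_subspaceT.
- split.
  + by move=> x _; case: (is_derive_expRZ c x).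
  + apply: cvg_at_right_filter; exact: continuous_expRZ.
  + apply: cvg_at_left_filter; exact: continuous_expRZ.
- by move=> x _; rewrite derive1E; case: (is_derive_expRZ c x).
Qed.

End Exponential.

Section Weight.
Context {R : realType} {X : completeNormedModType R}.
Local Notation leb := (@lebesgue_measure R).
Variable zeta : R -> {linear X -> X}.
Hypothesis hzeta : forall t, I10 t -> bounded_op (zeta t).
Hypothesis hzeta_bv : op_bounded_variation zeta (-1) 0.
Variables lambda mu : R.
Hypothesis hmu : lambda < mu.
Hypothesis hmu_large : (tv zeta 0 - tv zeta (-1)) * exp_tv_integral zeta mu (-1)
                 < (mu - lambda) ^+ 2.

Local Notation v := (tv zeta).
Local Notation V := (tv zeta 0 - tv zeta (-1)).
Local Notation m := (mu - lambda).
Local Notation h := (fun t : R => expR (2 * mu * t)).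
Local Notation tau := (delay_weight zeta lambda mu).

Let vnd : nondecreasing_I10 v := tv_nondecreasing hzeta_bv.

Lemma tv_width_ge0 : 0 <= V.
Proof. by rewrite subr_ge0 vnd// lerN10. Qed.

Lemma expR_tv_integrable :
  leb.-integrable I10 (EFin \o (fun x => v x * (2 * mu * expR (2 * mu * x)))).
Proof.
by apply: nondecreasing_I10_mul_integrable => //; case: (primitive_of_expRZ (2 * mu)).
Qed.

Lemma is_RS_integral_exp_tv (s t : R) : -1 <= s -> s <= t -> t <= 0 ->
  is_RS_integral (fun dv x : R => x * dv) v h s t
   (h t * v t - h s * v s -
    \int[leb]_(x in `]s, t]) (v x * (2 * mu * expR (2 * mu * x)))).
Proof.
move=> s1 st t0.
exact: (is_RS_integral_primitive (primitive_of_expRZ (2 * mu)) vnd).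
Qed.

Lemma exp_tv_integralE (t : R) : -1 <= t -> t <= 0 ->
  exp_tv_integral zeta mu t = v 0 - h t * v t -
    \int[leb]_(x in `]t, 0]) (v x * (2 * mu * expR (2 * mu * x))).
Proof.
move=> t1 t0; rewrite /exp_tv_integral /RS_integral_real.
rewrite (RS_integralE t0 (is_RS_integral_exp_tv t1 t0 (lexx _))).
by rewrite mulr0 expR0 mul1r.
Qed.

(** The upper bound is nonnegativity of the integral over [-1, t]. Additivity in the interval is
    read off the closed formulas; a jump at t is split consistently because both use the same value
    [tv zeta t]. *)
Lemma exp_tv_integral_bounds (t : R) : -1 <= t -> t <= 0 ->
  0 <= exp_tv_integral zeta mu t <= exp_tv_integral zeta mu (-1).
Proof.
move=> t1 t0; apply/andP; split.
  rewrite /exp_tv_integral /RS_integral_real.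
  rewrite (RS_integralE t0 (is_RS_integral_exp_tv t1 t0 (lexx _))).
  apply: (is_RS_integral_ge0 vnd t1 t0 (lexx _) _ (is_RS_integral_exp_tv t1 t0 (lexx _))).
  by move=> x; exact: expR_ge0.
have := is_RS_integral_ge0 vnd (lexx _) t1 t0 (fun x => expR_ge0 _)
  (is_RS_integral_exp_tv (lexx _) t1 t0).
rewrite !exp_tv_integralE// ?lerN10//.
rewrite (@Rintegral_itvoc_cat _ _ (-1) t 0)//; first lra.
exact: expR_tv_integrable.
Qed.

(** The bracket lies between its value c at -1, positive exactly by the condition on mu, and m. The
    exponential lies between the exponentials of -2|mu| and 2|mu|. *)
Lemma delay_weight_bounds : exists a b : R, 0 < a /\
  forall t, I10 t -> a <= tau t <= b.
Proof.
have m0 : 0 < m by rewrite subr_gt0.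
pose c := m - V / m * exp_tv_integral zeta mu (-1).
have c0 : 0 < c.
  by rewrite /c subr_gt0 mulrAC ltr_pdivrMr// -expr2.
exists (expR (- (2 * `|mu|)) * c), (expR (2 * `|mu|) * m); split.
  by rewrite mulr_gt0// expR_gt0.
move=> t; rewrite I10E => /andP[t1 t0].
have /andP[H0 H1] := exp_tv_integral_bounds t1 t0.
have Vm : 0 <= V / m by rewrite divr_ge0// ?tv_width_ge0// ltW.
have mt : `|2 * mu * t| <= 2 * `|mu|.
  rewrite !normrM (ger0_norm (ler0n _ 2)) -mulrA ler_pM2l//.
  by rewrite ler_piMr// ler_norml t1 (le_trans t0).
move: mt; rewrite ler_norml => /andP[mt1 mt2].
rewrite /delay_weight; apply/andP; split; apply: ler_pM.
- exact: expR_ge0.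
- exact: ltW.
- by rewrite ler_expR lerN2.
- by rewrite lerD2l lerN2 ler_wpM2l.
- exact: expR_ge0.
- by apply: le_trans (ltW c0) _; rewrite lerD2l lerN2 ler_wpM2l.
- by rewrite ler_expR lerNl.
- by rewrite gerDl oppr_le0 mulr_ge0.
Qed.

(** The degenerate interval [0, 0] carries no mass even if the variation jumps at 0: such a jump
    lowers the weight to the left of 0 but not at 0 itself. *)
Lemma delay_weight0 : tau 0 = m.
Proof.
rewrite /delay_weight exp_tv_integralE ?lerN10// set_itv_ge ?bnd_simp ?ltxx//.
by rewrite Rintegral_set0 !mulr0 oppr0 expR0; ring.
Qed.

(* Integrating the exponential by parts in the Stieltjes integral moves all the
   jumps of the weight into a multiple of [tv]. *)
Definition weight_ac (t : R) : R := expR (- (2 * mu) * t) *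
  (m - V / m * (v 0 -
     \int[leb]_(x in `]t, 0]) (v x * (2 * mu * expR (2 * mu * x))))).

Lemma delay_weightE (t : R) : -1 <= t -> t <= 0 ->
  tau t = weight_ac t + V / m * v t.
Proof.
move=> t1 t0; rewrite /delay_weight /weight_ac exp_tv_integralE//.
rewrite -mulNr; set I := \int[_]_(x in _) _.
rewrite (_ : m - _ = m - V / m * (v 0 - I) + V / m * (h t * v t)); last by ring.
rewrite mulrDr; congr (_ + _).
rewrite (_ : _ * _ = V / m * v t * (expR (- (2 * mu) * t) * h t)); last by ring.
by rewrite -expRD mulNr addNr expR0 mulr1.
Qed.

(** The full weight appears in the density: differentiating the tail integral gives - (V / m) 2 mu v
    after the exponentials cancel, which is - 2 mu times the part of tau missing from
    [weight_ac]. *)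
Lemma weight_ac_primitive :
  primitive_of weight_ac (fun t => - (2 * mu) * tau t).
Proof.
pose k x := v x * (2 * mu * expR (2 * mu * x)).
pose q t := m - V / m * (v 0 - \int[leb]_(x in `]t, 0]) k x).
have ik : leb.-integrable I10 (EFin \o k) := expR_tv_integrable.
have qP : primitive_of q (fun x => - (V / m) * k x).
  split; first by apply: integrable_scale => //; exact: measurable_I10.
  move=> s t s1 st t0; rewrite RintegralZl//; last exact: integrable_itvoc.
  rewrite /q (@Rintegral_itvoc_cat _ k s t 0)//; ring.
have := primitive_of_mul (primitive_of_expRZ (- (2 * mu))) qP.
set F := fun x => _ + _; move=> [iF eF].
have FE x : I10 x -> F x = - (2 * mu) * tau x.
  rewrite I10E => /andP[x1 x0]; rewrite delay_weightE// /F /weight_ac -/(q x) /k.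
  set E := expR (- (2 * mu) * x).
  have EE : E * expR (2 * mu * x) = 1 by rewrite -expRD mulNr addNr expR0.
  rewrite (_ : E * (- (V / m) * _) =
    - (V / m) * (2 * mu) * v x * (E * expR (2 * mu * x))); last by ring.
  by rewrite EE; ring.
split.
  by apply: eq_integrable iF; [exact: measurable_I10|move=> x; rewrite inE => Ix /=; rewrite FE].
move=> s t s1 st t0; rewrite [LHS]eF//; apply: eq_Rintegral => x; rewrite inE => xst.
by apply: FE; exact: sub_itvoc_I10 xst.
Qed.

Lemma delay_weight_measurable :
  measurable_fun (I10 : set (measurableTypeR R)) tau.
Proof.
apply: (eq_measurable_fun (fun x : measurableTypeR R => weight_ac x + V / m * v x)).
  by move=> x; rewrite inE I10E => /andP[x1 x0]; rewrite delay_weightE.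
apply: measurable_funD; first exact: primitive_of_measurable weight_ac_primitive.
apply: measurable_funM; first exact: measurable_cst.
exact: nondecreasing_I10_measurable.
Qed.

Lemma delay_weight_mul_integrable (g : R -> R) :
  leb.-integrable I10 (EFin \o g) ->
  leb.-integrable I10 (EFin \o (fun x => tau x * g x)).
Proof.
have [a [b [a0 ab]]] := delay_weight_bounds.
apply: (bounded_mul_integrable_I10 delay_weight_measurable (M := b)) => x /ab /andP[ax xb].
by rewrite ger0_norm// (le_trans (ltW a0)).
Qed.

(** The equation for the weight tested against u. With tau = [weight_ac] + (V / m) v, the first part
    obeys the product rule, while for the second the formula for J gives the integral of v g,
    boundary terms included. *)
Lemma delay_weight_by_parts (u g : R -> R) (J : R) : primitive_of u g ->
  is_RS_integral (fun dv x : R => x * dv) v u (-1) 0 J ->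
  \int[leb]_(x in I10) (tau x * g x) =
  m * u 0 - tau (-1) * u (-1) + 2 * mu * \int[leb]_(x in I10) (tau x * u x)
    - V / m * J.
Proof.
move=> ug hJ; have [ig ue] := ug.
have N10 : (-1 : R) <= 0 by rewrite lerN10.
have -> : J = u 0 * v 0 - u (-1) * v (-1) - \int[leb]_(x in `](-1), 0]) (v x * g x).
  apply: (is_RS_integral_unique N10 hJ).
  exact: is_RS_integral_primitive.
have iu : leb.-integrable I10 (EFin \o u).
  have [M uM] := primitive_of_bounded ug.
  exact: bounded_integrable_I10 (primitive_of_measurable ug) uM.
have itg := delay_weight_mul_integrable ig.
have itu := delay_weight_mul_integrable iu.
have ivg := nondecreasing_I10_mul_integrable vnd ig.
have iwg := primitive_of_mul_integrable weight_ac_primitive ig.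
rewrite !Rintegral_I10_itvoc//.
have oc1 (f : R -> R) : leb.-integrable I10 (EFin \o f) ->
  leb.-integrable `](-1), 0] (EFin \o f) by exact: integrable_itvoc.
have -> : \int[leb]_(x in `](-1), 0]) (tau x * g x) =
    \int[leb]_(x in `](-1), 0]) (weight_ac x * g x) +
    V / m * \int[leb]_(x in `](-1), 0]) (v x * g x).
  rewrite -RintegralZl//; last exact: oc1.
  rewrite -RintegralD//; [|exact: oc1|by apply: integrable_scale => //; exact: oc1].
  apply: eq_Rintegral => x; rewrite inE => /(sub_itvoc_I10 (lexx _) (lexx _)).
  by rewrite I10E => /andP[x1 x0]; rewrite delay_weightE//; ring.
have [_ /(_ _ _ (lexx _) N10 (lexx _))] := primitive_of_mul weight_ac_primitive ug.
rewrite (_ : m * u 0 = tau 0 * u 0); last by rewrite delay_weight0.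
rewrite !delay_weightE//.
have -> : \int[leb]_(x in `](-1), 0])
    (- (2 * mu) * tau x * u x + weight_ac x * g x) =
    - (2 * mu) * \int[leb]_(x in `](-1), 0]) (tau x * u x) +
    \int[leb]_(x in `](-1), 0]) (weight_ac x * g x).
  rewrite -RintegralZl//; last exact: oc1.
  rewrite -RintegralD//; [|by apply: integrable_scale => //; exact: oc1|exact: oc1].
  by apply: eq_Rintegral => x _; rewrite mulrA.
set A := \int[_]_(x in _) _; set B := \int[_]_(x in _) _.
set C := \int[_]_(x in _) _; move=> E.
rewrite (_ : B = weight_ac 0 * u 0 - weight_ac (-1) * u (-1) + 2 * mu * A); last first.
  by rewrite E; ring.
by ring.
Qed.

End Weight.

(** * The weighted inner product *)

Section HilbertSpace.
Context {R : realType} {X : completeNormedModType R}.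
Variable ip : X -> X -> R.
Hypothesis hX : is_hilbert ip.

Lemma ipC x y : ip x y = ip y x.
Proof. by case: hX => -[]. Qed.

Lemma ip_linl a x y z : ip (a *: x + y) z = a * ip x z + ip y z.
Proof. by case: hX => -[]. Qed.

Lemma ip0l z : ip 0 z = 0.
Proof.
have := ip_linl 1 0 0 z; rewrite scaler0 addr0 mul1r => /eqP.
by rewrite -subr_eq0 opprD addrA subrr add0r oppr_eq0 => /eqP.
Qed.

Lemma ipDl x y z : ip (x + y) z = ip x z + ip y z.
Proof. by rewrite -[x in LHS]scale1r ip_linl mul1r. Qed.

Lemma ipZl a x z : ip (a *: x) z = a * ip x z.
Proof. by rewrite -[a *: x]addr0 ip_linl ip0l addr0. Qed.

Lemma ipNl x z : ip (- x) z = - ip x z.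
Proof. by rewrite -scaleN1r ipZl mulN1r. Qed.

Lemma ipBl x y z : ip (x - y) z = ip x z - ip y z.
Proof. by rewrite ipDl ipNl. Qed.

Lemma ipDr x y z : ip z (x + y) = ip z x + ip z y.
Proof. by rewrite ipC ipDl !(ipC z). Qed.

Lemma ipZr a x z : ip z (a *: x) = a * ip z x.
Proof. by rewrite ipC ipZl (ipC z). Qed.

Lemma ipBr x y z : ip z (x - y) = ip z x - ip z y.
Proof. by rewrite ipC ipBl !(ipC z). Qed.

Lemma ip_sqr x : ip x x = `|x| ^+ 2.
Proof. by case: hX => -[_ _ p0 _] ->; rewrite /ip_norm sqr_sqrtr. Qed.

(** It reduces measurability and integrability of inner products to those of squared norms. *)
Lemma ip_polarization x y :
  ip x y = 2^-1 * (`|x + y| ^+ 2 - `|x| ^+ 2 - `|y| ^+ 2).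
Proof. by rewrite -!ip_sqr ipDl !ipDr (ipC y x); field. Qed.

Lemma ip_cauchy_schwarz x y : `|ip x y| <= `|x| * `|y|.
Proof.
have [->|y0] := eqVneq y 0; first by rewrite ipC ip0l !normr0 mulr0.
have ny : 0 < `|y| by rewrite normr_gt0.
rewrite -[leLHS]ger0_norm// -[leRHS]ger0_norm ?mulr_ge0//.
rewrite -ler_sqr ?nnegrE// !real_normK ?num_real// exprMn.
have : 0 <= ip (x - (ip x y / `|y| ^+ 2) *: y) (x - (ip x y / `|y| ^+ 2) *: y).
  by rewrite ip_sqr sqr_ge0.
rewrite !(ipBl, ipBr, ipZl, ipZr) !ip_sqr (ipC y x).
set p := ip x y.
rewrite [X in 0 <= X](_ : _ = (`|x| ^+ 2 * `|y| ^+ 2 - p ^+ 2) / `|y| ^+ 2); last first.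
  by field; rewrite gt_eqF.
by rewrite pmulr_lge0 ?invr_gt0 ?exprn_gt0// subr_ge0.
Qed.

End HilbertSpace.

#[local] Instance lebesgue_ae_filter {R : realType} :
  Filter (nbhs (almost_everywhere (@lebesgue_measure R))).
Proof. exact: ae_filter_ringOfSetsType. Qed.

Section WeightedInnerProduct.
Context {R : realType} {X : completeNormedModType R}.
Local Notation leb := (@lebesgue_measure R).
Variable ip : X -> X -> R.
Hypothesis hX : is_hilbert ip.
Implicit Types f g : L2fun X.

Lemma L2fun_measurable f : strongly_measurable f.
Proof. by case: f => f /= /L2predP[]. Qed.

Lemma L2fun_sqr_integrable f :
  leb.-integrable I10 (EFin \o (fun t => `|f t| ^+ 2)).
Proof.
have /L2predP[mf sf] := valP f; apply/integrableP; split.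
  apply/measurable_EFinP; apply: measurable_funX.
  exact: strongly_measurable_norm.
move: sf; rewrite /square_integrable; congr (_ < _)%E.
by apply: eq_integral => x _ /=; rewrite ger0_norm// sqr_ge0.
Qed.

Lemma strongly_measurable_ip (f g : R -> X) :
  strongly_measurable f -> strongly_measurable g ->
  measurable_fun (I10 : set (measurableTypeR R)) (fun t => ip (f t) (g t)).
Proof.
move=> mf mg.
under eq_fun do rewrite (ip_polarization hX).
apply: measurable_funM; first exact: measurable_cst.
have msq (k : R -> X) : strongly_measurable k ->
    measurable_fun (I10 : set (measurableTypeR R)) (fun t => `|k t| ^+ 2).
  by move=> mk; apply: measurable_funX; exact: strongly_measurable_norm.
apply: measurable_funB; last exact: msq.
apply: measurable_funB; last exact: msq.
have := strongly_measurable_lin 1 mf mg; rewrite scale1r; exact: msq.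
Qed.

Lemma L2fun_ip_integrable f g :
  leb.-integrable I10 (EFin \o (fun t => ip (f t) (g t))).
Proof.
have mI := @measurable_I10 R.
have iF : leb.-integrable I10 (EFin \o
    (fun t => 2^-1 * (`|(f + g) t| ^+ 2 - `|f t| ^+ 2 - `|g t| ^+ 2))).
  by apply: integrable_scale => //; apply: integrable_sub => //;
    [apply: integrable_sub => //|]; exact: L2fun_sqr_integrable.
by apply: eq_integrable iF => // t _; rewrite /= (ip_polarization hX).
Qed.

Lemma L2fun_norm_integrable f :
  leb.-integrable I10 (EFin \o (fun t => `|f t|)).
Proof.
have mI := @measurable_I10 R.
(* On an interval of finite length, |f| <= 1 + |f|^2 gives integrability from square
   integrability. *)
have i1 : leb.-integrable I10 (EFin \o (fun t => 1 + `|f t| ^+ 2)).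
  apply: integrable_add => //; last exact: L2fun_sqr_integrable.
  by apply: (@bounded_integrable_I10 _ _ 1) => //; rewrite normr1.
apply: le_integrable i1 => //.
  apply/measurable_EFinP; apply: strongly_measurable_norm.
  exact: L2fun_measurable.
move=> t _ /=; rewrite lee_fin normr_id ger0_norm ?addr_ge0 ?sqr_ge0//.
by have := sqr_ge0 (`|f t| - 1); have := normr_ge0 (f t); nra.
Qed.

Lemma eq_ae_Rintegral_I10 (f g : R -> R) :
  measurable_fun (I10 : set (measurableTypeR R)) f ->
  measurable_fun (I10 : set (measurableTypeR R)) g ->
  {ae leb, forall t, I10 t -> f t = g t} ->
  \int[leb]_(t in I10) f t = \int[leb]_(t in I10) g t.
Proof.
move=> mf mg fg; congr fine; apply: ae_eq_integral.
- exact: measurable_I10.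
- exact/measurable_EFinP.
- exact/measurable_EFinP.
by apply: filterS fg => t h /h ->.
Qed.

Variable tau : R -> R.
Variables a b : R.
Hypothesis a0 : 0 < a.
Hypothesis tau_bounds : forall t, I10 t -> a <= tau t <= b.
Hypothesis mtau : measurable_fun (I10 : set (measurableTypeR R)) tau.

Lemma weighted_ip_integrable f g :
  leb.-integrable I10 (EFin \o (fun t => tau t * ip (f t) (g t))).
Proof.
apply: (bounded_mul_integrable_I10 mtau (M := b)); last exact: L2fun_ip_integrable.
move=> x /tau_bounds /andP[ax xb].
by rewrite ger0_norm// (le_trans (ltW a0)).
Qed.

Lemma weighted_ip_class (c d : X) f g :
  weighted_ip ip tau (c, L2class f) (d, L2class g) =
  ip c d + \int[leb]_(t in I10) (tau t * ip (f t) (g t)).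
Proof.
rewrite /weighted_ip /=; congr (_ + _).
have mtf (k l : L2fun X) := integrable_I10_measurable (weighted_ip_integrable k l).
apply: eq_ae_Rintegral_I10; [exact: mtf|exact: mtf|].
apply: (filterS2 _ _ (L2classK f) (L2classK g)) => t hf hg It.
by rewrite hf// hg.
Qed.

Lemma weighted_ip_well_definedP : weighted_ip_well_defined ip tau.
Proof.
by move=> c d f g; split; [exact: weighted_ip_integrable|exact: weighted_ip_class].
Qed.

Lemma L2_linE (k : R) (F G : L2 X) :
  k *: F + G = L2class (k *: L2rep F + L2rep G).
Proof. by rewrite -L2class_add -L2class_scale !L2repK. Qed.

Lemma weighted_ip_diag (c : X) (F : L2 X) :
  weighted_ip ip tau (c, F) (c, F) =
  `|c| ^+ 2 + \int[leb]_(t in I10) (tau t * `|L2rep F t| ^+ 2).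
Proof.
rewrite /weighted_ip /= (ip_sqr hX); congr (_ + _).
by apply: eq_Rintegral => t _; rewrite (ip_sqr hX).
Qed.

Lemma weighted_sqr_integrable f :
  leb.-integrable I10 (EFin \o (fun t => tau t * `|f t| ^+ 2)).
Proof.
have := weighted_ip_integrable f f.
by apply: eq_integrable; [exact: measurable_I10|move=> t _; rewrite /= (ip_sqr hX)].
Qed.

Lemma weighted_sqr_bounds f :
  a * \int[leb]_(t in I10) `|f t| ^+ 2 <=
  \int[leb]_(t in I10) (tau t * `|f t| ^+ 2) <=
  b * \int[leb]_(t in I10) `|f t| ^+ 2.
Proof.
have mI := @measurable_I10 R.
rewrite -!RintegralZl//; try exact: L2fun_sqr_integrable.
by apply/andP; split; apply: le_Rintegral => //;
  try exact: weighted_sqr_integrable;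
  try (apply: integrable_scale => //; exact: L2fun_sqr_integrable);
  move=> t /tau_bounds /andP[at_ tb]; apply: ler_wpM2r => //; exact: sqr_ge0.
Qed.

Lemma weighted_ip_inner_product : is_inner_product (weighted_ip ip tau).
Proof.
split.
- move=> [c F] [d G]; rewrite /weighted_ip /= (ipC hX); congr (_ + _).
  by apply: eq_Rintegral => t _; rewrite (ipC hX).
- move=> k [c F] [d G] [e H]; rewrite -(L2repK H).
  rewrite -[X in weighted_ip _ _ X _]/(k *: c + d, k *: F + G) L2_linE.
  rewrite -[in RHS](L2repK F) -[in RHS](L2repK G) !weighted_ip_class.
  rewrite (ip_linl hX) mulrDr -RintegralZl//; first last.
  + exact: weighted_ip_integrable.
  + exact: measurable_I10.
  rewrite addrACA -RintegralD//; first last.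
  + exact: weighted_ip_integrable.
  + apply: integrable_scale; first exact: measurable_I10.
    exact: weighted_ip_integrable.
  + exact: measurable_I10.
  congr (_ + _); apply: eq_Rintegral => t _.
  rewrite (_ : L2fun_val (k *: L2rep F + L2rep G) t =
    k *: L2rep F t + L2rep G t)// (ip_linl hX); ring.
- move=> [c F]; rewrite weighted_ip_diag addr_ge0 ?sqr_ge0// Rintegral_ge0//.
  move=> t /tau_bounds /andP[at_ _].
  by rewrite mulr_ge0 ?sqr_ge0// (le_trans (ltW a0)).
- move=> [c F]; rewrite weighted_ip_diag => cF.
  (* Definiteness: since tau >= a > 0, a vanishing weighted integral forces the unweighted one to
     vanish, so the representative is zero almost everywhere. *)
  have /andP[lb _] := weighted_sqr_bounds (L2rep F).
  set I := \int[leb]_(t in I10) `|L2rep F t| ^+ 2 in lb.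
  have I0 : 0 <= I by apply: Rintegral_ge0 => t _; exact: sqr_ge0.
  have aI : 0 <= a * I by rewrite mulr_ge0// ltW.
  have c0 : `|c| ^+ 2 = 0 by apply/eqP; rewrite eq_le sqr_ge0 andbT; lra.
  have I00 : I = 0.
    apply/eqP; rewrite eq_le I0 andbT -(pmulr_rle0 _ a0).
    have := sqr_ge0 `|c|; lra.
  move/eqP : c0; rewrite sqrf_eq0 normr_eq0 => /eqP ->.
  congr (_, _); rewrite -(L2repK F); apply/L2class_eq.
  have mF := integrable_I10_measurable (L2fun_sqr_integrable (L2rep F)).
  have /(ae_eq_integral_abs leb (@measurable_I10 R)) : measurable_fun I10
      (EFin \o (fun t => `|L2rep F t| ^+ 2)) by exact/measurable_EFinP.
  move=> [/(_ _)H _].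
  have {}H := H _.
  apply: filterS (H _) => [t /= tF It|].
    have := tF It; move=> [/eqP]; rewrite sqrf_eq0 normr_eq0 => /eqP ->.
    by [].
  rewrite -[RHS]/(0%:E) -I00 /I /Rintegral fineK.
    by apply: eq_integral => t _ /=; rewrite ger0_norm// sqr_ge0.
  apply: integrable_fin_num; first exact: measurable_I10.
  exact: L2fun_sqr_integrable.
Qed.

Lemma weighted_ip_equivalent :
  equivalent_ip (weighted_ip ip tau) (canonical_ip ip).
Proof.
(* The comparison with 1 accounts for the X component, which carries weight 1. These constants
   compare squared norms, hence the square roots below. *)
pose al := Num.min 1 a; pose be := Num.max 1 b.
have al0 : 0 < al by rewrite lt_min ltr01.
have be0 : 0 < be by rewrite lt_max ltr01.
exists (Num.sqrt al), (Num.sqrt be); rewrite !sqrtr_gt0; split => // -[c F].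
rewrite /ip_norm -(sqrtrM _ (ltW al0)) -(sqrtrM _ (ltW be0)).
have -> : canonical_ip ip (c, F) (c, F) =
    `|c| ^+ 2 + \int[leb]_(t in I10) `|L2rep F t| ^+ 2.
  rewrite /canonical_ip /= (ip_sqr hX); congr (_ + _).
  by apply: eq_Rintegral => t _; rewrite (ip_sqr hX).
rewrite weighted_ip_diag.
have /andP[lb ub] := weighted_sqr_bounds (L2rep F).
have c0 : 0 <= `|c| ^+ 2 := sqr_ge0 _.
set I := \int[leb]_(t in I10) `|L2rep F t| ^+ 2 in lb ub *.
have I0 : 0 <= I by apply: Rintegral_ge0 => t _; exact: sqr_ge0.
have al1 : al <= 1 by rewrite ge_min lexx.
have ala : al <= a by rewrite ge_min lexx orbT.
have be1 : 1 <= be by rewrite le_max lexx.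
have beb : b <= be by rewrite le_max lexx orbT.
apply/andP; split; apply: ler_wsqrtr; rewrite mulrDr; apply: lerD.
- by rewrite ler_piMl.
- by apply: le_trans lb; exact: ler_wpM2r.
- by rewrite ler_peMl.
- by apply: (le_trans ub); exact: ler_wpM2r.
Qed.

End WeightedInnerProduct.

(** * Test functions *)

Section SmoothStep.
Context {R : realType}.
Local Notation leb := (@lebesgue_measure R).

(** The powers of 1/x are there so that the linear span of the family is closed under
    differentiation. *)
Definition flat_exp (n : nat) (x : R) : R :=
  if 0 < x then x^-1 ^+ n * expR (- x^-1) else 0.

Lemma flat_exp_ge0 n x : 0 <= flat_exp n x.
Proof.
rewrite /flat_exp; case: ifPn => // x0.
by rewrite mulr_ge0 ?expR_ge0// exprn_ge0// invr_ge0 ltW.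
Qed.

(** With y = 1/x and N = n + 1, the bound 1 + z <= exp z at z = y / N gives (y / N)^N <= exp y, that
    is y^n exp(-y) <= N^N / y. *)
Lemma flat_exp_le_linear n : exists C : R, forall x, 0 <= x ->
  flat_exp n x <= C * x.
Proof.
exists (n.+1%:R ^+ n.+1) => x; rewrite le_eqVlt => /predU1P[<-|x0].
  by rewrite /flat_exp ltxx mulr0.
rewrite /flat_exp x0; set y := x^-1.
have y0 : 0 < y by rewrite invr_gt0.
have N0 : (0 : R) < n.+1%:R by [].
have h1 : (y / n.+1%:R) ^+ n.+1 <= expR y.
  have -> : expR y = expR (y / n.+1%:R) ^+ n.+1.
    by rewrite -expRM_natl mulrCA divff ?mulr1// gt_eqF.
  rewrite lerXn2r// ?nnegrE ?expR_ge0 ?divr_ge0 ?(ltW y0)//.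
  by apply: le_trans (expR_ge1Dx _); rewrite lerDr.
rewrite expRN ler_pdivrMr ?expR_gt0//.
have -> : x = y^-1 by rewrite invrK.
rewrite -mulrA mulrCA ler_pdivlMl// -exprS.
by rewrite mulrC -ler_pdivrMr ?exprn_gt0// -expr_div_n.
Qed.

Lemma is_derive_flat_exp n (x : R) :
  is_derive x 1 (flat_exp n) (flat_exp n.+2 x - n%:R * flat_exp n.+1 x).
Proof.
have [x0|x0|->] := ltrgtP x 0.
- rewrite /flat_exp ltNge (ltW x0)/= mulr0 subr0.
  apply: (near_eq_is_derive _ (is_derive_cst (0 : R) x 1)).
  near=> y; have y0 : y < 0 by near: y; exact: lt_nbhsl.
  by rewrite /flat_exp ltNge (ltW y0).
- rewrite /flat_exp x0.
  apply: (@near_eq_is_derive R R R (fun y : R => y^-1 ^+ n * expR (- y^-1))).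
    near=> y; have y0 : 0 < y by near: y; exact: lt_nbhsr.
    by rewrite /flat_exp y0.
  have nx : x != 0 by rewrite gt_eqF.
  have H1 : is_derive x 1 (fun y : R => y^-1) (- x ^- 2).
    by have := is_deriveV nx (is_derive_id x 1); rewrite /GRing.scale /= mulr1.
  have H2 := is_deriveX n H1.
  have H3 : is_derive x 1 (fun y : R => expR (- y^-1)) (expR (- x^-1) * x ^- 2).
    have := @is_derive1_comp _ (@expR R) (fun y => - y^-1) x _ _
      (is_derive_expR _) (is_deriveN H1).
    by rewrite opprK.
  have := is_deriveM H2 H3.
  rewrite (_ : (fun y => y^-1) ^+ n * _ = (fun y : R => y^-1 ^+ n * expR (- y^-1))).
    move=> H; apply: is_derive_eq H _; rewrite /GRing.scale /= fctE.
    rewrite -exprVn; set y := x^-1; set E := expR _.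
    case: n {H2} => [|n]; first by rewrite !mul0r mulr0 !subr0 addr0 expr0 mul1r mulrC.
    by rewrite /= !exprS; ring.
  by apply/funext => y; rewrite !fctE.
- rewrite /flat_exp ltxx mulr0 subr0.
  (* For h > 0 the difference quotient at 0 is [flat_exp n.+1 h], which is at most C h; for h < 0 it
     is 0. *)
  have [C hC] := flat_exp_le_linear n.+1.
  suff H : h^-1 *: (flat_exp n (h *: 1 + 0) - flat_exp n 0) @[h --> 0^'] --> (0 : R).
    split; first by apply/cvg_ex; exists 0.
    exact/cvg_lim.
  apply/cvgrPdist_le => e e0.
  have C0 : 0 < `|C| + 1 by rewrite ltr_wpDl.
  near=> h.
  have hn : h != 0 by near: h; exact: nbhs_dnbhs_neq.
  have he : `|h| < e / (`|C| + 1).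
    near: h; apply: dnbhs0_lt; exact: divr_gt0.
  rewrite (_ : h *: 1 = h); last exact: mulr1.
  rewrite addr0 (_ : flat_exp n 0 = 0); last by rewrite /flat_exp ltxx.
  rewrite subr0 sub0r normrN -[_ *: _]/(h^-1 * flat_exp n h).
  rewrite /flat_exp; case: ifPn => h0; last by rewrite mulr0 normr0 ltW.
  have := hC h (ltW h0); have := flat_exp_ge0 n.+1 h.
  rewrite /flat_exp h0 exprS -mulrA => f0 fC; rewrite ger0_norm//.
  apply: (le_trans fC); move: he; rewrite gtr0_norm// => he.
  apply: (@le_trans _ _ ((`|C| + 1) * h)); last by rewrite mulrC -ler_pdivlMr// ltW.
  by rewrite ler_pM2r// (le_trans (ler_norm C))// lerDl.
Unshelve. all: by end_near. Qed.

(* This class is closed under differentiation, which makes its members smooth. *)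
Inductive smooth_expr : (R -> R) -> Prop :=
| SmoothCst c : smooth_expr (fun=> c)
| SmoothFlat n : smooth_expr (flat_exp n)
| SmoothAdd f g : smooth_expr f -> smooth_expr g -> smooth_expr (fun x => f x + g x)
| SmoothMul f g : smooth_expr f -> smooth_expr g -> smooth_expr (fun x => f x * g x)
| SmoothInv f : smooth_expr f -> (forall x, f x != 0) ->
    smooth_expr (fun x => (f x)^-1)
| SmoothAffine f a b : smooth_expr f -> smooth_expr (fun x => f (a * x + b)).

Lemma is_derive_affine (a b x : R) : is_derive x 1 (fun t : R => a * t + b) a.
Proof.
have := is_deriveD (is_deriveZ a (is_derive_id x 1)) (is_derive_cst b x 1).
by rewrite addr0 /GRing.scale /= mulr1.
Qed.

Lemma smooth_expr_derive f : smooth_expr f ->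
  exists2 f', smooth_expr f' & forall x : R, is_derive x 1 f (f' x).
Proof.
elim=> [c|n|{}f g sf [f' sf' df] sg [g' sg' dg]|{}f g sf [f' sf' df] sg [g' sg' dg]
  |{}f sf [f' sf' df] nf|{}f a b sf [f' sf' df]].
- by exists (fun=> 0); [exact: SmoothCst|move=> x; exact: is_derive_cst].
- exists (fun x => flat_exp n.+2 x + (- n%:R) * flat_exp n.+1 x).
    apply: SmoothAdd; first exact: SmoothFlat.
    by apply: (SmoothMul (SmoothCst _)); exact: SmoothFlat.
  by move=> x; rewrite mulNr; exact: is_derive_flat_exp.
- exists (fun x => f' x + g' x); first exact: SmoothAdd.
  by move=> x; exact: is_deriveD.
- exists (fun x => f x * g' x + g x * f' x).
    by apply: SmoothAdd; exact: SmoothMul.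
  by move=> x; exact: is_deriveM.
- exists (fun x => (- 1) * ((f x)^-1 * (f x)^-1) * f' x).
    apply: SmoothMul => //; apply: (SmoothMul (SmoothCst _)).
    by apply: SmoothMul; exact: SmoothInv.
  move=> x; apply: is_derive_eq (is_deriveV (nf x) (df x)) _.
  by rewrite /GRing.scale /= -exprVn expr2 mulN1r.
- exists (fun x => f' (a * x + b) * a).
    by apply: SmoothMul; [exact: SmoothAffine|exact: SmoothCst].
  move=> x.
  exact: (@is_derive1_comp _ f (fun t => a * t + b) x _ _ (df _) (is_derive_affine a b x)).
Qed.

Lemma smooth_expr_derivable_n f n : smooth_expr f ->
  smooth_expr (derive1n n f).
Proof.
move=> sf; elim: n => [//|n ih]; rewrite derive1nS.
have [g sg dg] := smooth_expr_derive ih.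
rewrite (_ : derive1 _ = g)//; apply/funext => x.
by rewrite derive1E; case: (dg x).
Qed.

Lemma smooth_expr_derivable f x : smooth_expr f -> derivable f x 1.
Proof. by move=> /smooth_expr_derive[g _ /(_ x) []]. Qed.

Lemma smooth_expr_continuous f : smooth_expr f -> continuous f.
Proof.
move=> sf x; apply/differentiable_continuous/derivable1_diffP.
exact: smooth_expr_derivable.
Qed.

(** The quotient F(x) / (F(x) + F(1 - x)) with F = [flat_exp 0]. Its denominator is positive since x
    or 1 - x is, and its derivative is bounded by compactness of [0, 1]. *)
Lemma smooth_step : exists eta eta' : R -> R, exists C : R,
  [/\ smooth_expr eta,
      smooth_expr eta' /\ (forall x : R, is_derive x 1 eta (eta' x)),
      (forall x, x <= 0 -> eta x = 0) /\ (forall x, 1 <= x -> eta x = 1),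
      forall x, `|eta x| <= 1
    & (forall x, `|eta' x| <= C) /\ (forall x, x <= 0 \/ 1 < x -> eta' x = 0)].
Proof.
pose d (x : R) := flat_exp 0 x + flat_exp 0 (-1 * x + 1).
pose eta (x : R) := flat_exp 0 x * (d x)^-1.
have pos (x : R) : 0 < x -> 0 < flat_exp 0 x.
  by move=> x0; rewrite /flat_exp x0 expr0 mul1r expR_gt0.
have neg (x : R) : x <= 0 -> flat_exp 0 x = 0 by rewrite /flat_exp ltNge => ->.
have d0 x : 0 < d x.
  have [x0|x0] := leP x 0.
    by rewrite /d neg// add0r pos//; lra.
  by rewrite /d ltr_pwDl ?pos// flat_exp_ge0.
have sd : smooth_expr d.
  by apply: SmoothAdd; [exact: SmoothFlat|apply: SmoothAffine; exact: SmoothFlat].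
have seta : smooth_expr eta.
  apply: SmoothMul; first exact: SmoothFlat.
  by apply: SmoothInv => // x; rewrite gt_eqF.
have [eta' seta' deta] := smooth_expr_derive seta.
have eta0 x : x <= 0 -> eta x = 0 by move=> x0; rewrite /eta neg// mul0r.
have eta1 x : 1 <= x -> eta x = 1.
  move=> x1; rewrite /eta /d (neg (-1 * x + 1)) ?addr0 ?divff//; last lra.
  by rewrite gt_eqF// pos//; lra.
(* The left case includes 0, where eta is not locally constant, so it uses the product rule:
   [flat_exp 0] vanishes there with its derivative. To the right of 1, eta is locally constant. *)
have eta'0 x : x <= 0 \/ 1 < x -> eta' x = 0.
  move=> x01; have /(_ x) [_ <-] := deta.
  suff [] : is_derive x 1 eta 0 by [].
  have [x0|x1] := x01.
    have sd1 : smooth_expr (fun y => (d y)^-1).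
      by apply: SmoothInv => // y; rewrite gt_eqF.
    have [d' _ /(_ x) dd'] := smooth_expr_derive sd1.
    apply: is_derive_eq (is_deriveM (is_derive_flat_exp 0 x) dd') _.
    by rewrite /flat_exp ltNge x0 /= mulr0 subr0 scale0r scaler0 addr0.
  apply: (near_eq_is_derive _ (is_derive_cst (1 : R) x 1)).
  near=> y; have y1 : 1 < y by near: y; exact: lt_nbhsr.
  by rewrite eta1// ltW.
have [C hC] : exists C : R, forall x, 0 <= x <= 1 -> `|eta' x| <= C.
  have : bounded_set (eta' @` `[0, 1]).
    apply: compact_bounded; apply: continuous_compact; last exact: segment_compact.
    by apply: continuous_subspaceT; exact: smooth_expr_continuous.
  move=> [M [_ HM]]; exists (M + 1) => x x01; apply: (HM (M + 1)); first by rewrite ltrDl.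
  by exists x => //=; rewrite in_itv.
exists eta, eta', `|C|; split => //.
- move=> x; rewrite /eta normrM normfV (gtr0_norm (d0 x)) ger0_norm ?flat_exp_ge0//.
  by rewrite ler_pdivrMr// mul1r lerDl flat_exp_ge0.
- split => // x; have [x0|x0] := ltP x 0; first by rewrite eta'0 ?normr0//; left; exact: ltW.
  have [x1|x1] := leP x 1; last by rewrite eta'0 ?normr0//; right.
  by apply: (le_trans (hC _ _)); rewrite ?x0// ler_norm.
Unshelve. all: by end_near. Qed.

End SmoothStep.

(** * The scalar du Bois-Reymond lemma *)

Section DuBoisReymond.
Context {R : realType}.
Local Notation leb := (@lebesgue_measure R).

Lemma Rintegral_dominated_cvg (f_ : nat -> R -> R) (f g : R -> R) :
  (forall n, measurable_fun (I10 : set (measurableTypeR R)) (f_ n)) ->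
  measurable_fun (I10 : set (measurableTypeR R)) f ->
  (forall x, I10 x -> f_ n x @[n --> \oo] --> f x) ->
  leb.-integrable I10 (EFin \o g) ->
  (forall n x, I10 x -> `|f_ n x| <= g x) ->
  \int[leb]_(x in I10) f_ n x @[n --> \oo] --> \int[leb]_(x in I10) f x.
Proof.
move=> mf_ mf f_f ig f_g.
have [] := @dominated_convergence _ _ _ leb _ (@measurable_I10 R)
  (fun n x => (f_ n x)%:E) (fun x => (f x)%:E) (fun x => (g x)%:E).
- by move=> n; apply/measurable_EFinP.
- exact/measurable_EFinP.
- by apply: aeW => x Ix; apply: cvg_EFin; [exact: nearW|exact: f_f].
- exact: ig.
- by apply: aeW => x n Ix; rewrite lee_fin f_g.
move=> iF _ H; rewrite /Rintegral; apply: fine_cvg.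
by rewrite fineK//; apply: integrable_fin_num => //; exact: measurable_I10.
Qed.

(** The right-hand interval sits inside the ball of radius 2 e, whose measure is 4 e. Radius e would
    not do, since balls are open and c + e must belong. *)
Lemma Rintegral_davg_le (k : R -> R) (c e : R) :
  leb.-integrable I10 (EFin \o k) -> -1 < c -> 0 < e -> c + e <= 0 ->
  davg (k \_ I10) c (2 * e) \is a fin_num ->
  \int[leb]_(x in `]c, (c + e)%R]) `|k x - k c| <=
    4 * e * fine (davg (k \_ I10) c (2 * e)).
Proof.
move=> ik c1 e0 ce0 fd.
have c0 : c <= 0 by lra.
have e2 : 0 <= 2 * e by lra.
have mI := @measurable_I10 R.
have mk : measurable_fun setT (k \_ I10).
  by apply/(measurable_restrictT _ mI); exact: integrable_I10_measurable.
have kc : (k \_ I10) c = k c by rewrite patchT// inE I10E c0 (ltW c1).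
have ikc : leb.-integrable `]c, (c + e)%R] (EFin \o (fun x => `|k x - k c|)).
  apply: integrable_normr => //; apply: integrable_sub => //.
    exact: integrable_itvoc (ltW c1) ce0 ik.
  apply: (integrable_itvoc (ltW c1) ce0).
  by apply: (bounded_integrable_I10 (M := `|k c|)) => //; exact: measurable_cst.
rewrite -lee_fin EFinM (fineK fd).
have -> : (\int[leb]_(x in `]c, (c + e)%R]) `|k x - k c|)%:E =
    (\int[leb]_(x in `]c, (c + e)%R]) (`|k x - k c|)%:E)%E.
  by rewrite /Rintegral fineK//; apply: integrable_fin_num.
rewrite /davg /iavg lebesgue_measure_ball// muleA.
have -> : ((4 * e)%:E * ((2 * e) *+ 2)%:E^-1 = 1%:E)%E.
  rewrite inver ifF; last by apply/negbTE; lra.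
  rewrite -EFinM; congr EFin; rewrite mulr2n; field; lra.
rewrite mul1e.
apply: (@le_trans _ _ (\int[leb]_(y in `]c, (c + e)%R])
   `|((center ((k \_ I10) c) \o k \_ I10) y)%:E|)%E).
  rewrite le_eqVlt; apply/orP; left; apply/eqP; apply: eq_integral => x.
  rewrite inE => xc /=; rewrite kc patchT ?inE//.
  exact: sub_itvoc_I10 (ltW c1) ce0 _ xc.
apply: ge0_subset_integral => //.
- exact: measurable_ball.
- apply: measurableT_comp => //; apply/measurable_EFinP.
  apply: measurable_funTS; apply: measurable_funB => //.
- move=> x /=; rewrite in_itv/= => /andP[cx xe]; rewrite /ball/=.
  by rewrite distrC ger0_norm; lra.
Qed.

Section Step.
Variables eta eta' : R -> R.
Variable C : R.
Hypothesis seta : smooth_expr eta.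
Hypothesis seta' : smooth_expr eta'.
Hypothesis deta : forall x : R, is_derive x 1 eta (eta' x).
Hypothesis eta0 : forall x, x <= 0 -> eta x = 0.
Hypothesis eta1 : forall x, 1 <= x -> eta x = 1.
Hypothesis eta_le1 : forall x, `|eta x| <= 1.
Hypothesis eta'_le : forall x, `|eta' x| <= C.
Hypothesis eta'0 : forall x, x <= 0 \/ 1 < x -> eta' x = 0.

(** It rises from 0 to 1 between c and c + e, so its derivative is a mollifier to the right of c.
    The argument is written in the affine form expected by [SmoothAffine]. *)
Definition step (c e t : R) : R := eta (e^-1 * t + - (c / e)).
Definition step' (c e t : R) : R := eta' (e^-1 * t + - (c / e)) * e^-1.

Lemma step_arg (c e t : R) : e^-1 * t + - (c / e) = (t - c) / e.
Proof. by rewrite mulrC -mulrBl. Qed.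

Lemma is_derive_step c e (t : R) : is_derive t 1 (step c e) (step' c e t).
Proof.
exact: (@is_derive1_comp _ eta (fun t => e^-1 * t + - (c / e)) t _ _ (deta _)
  (is_derive_affine _ _ _)).
Qed.

Lemma smooth_step_fun c e : smooth_expr (step c e).
Proof. exact: SmoothAffine. Qed.

Lemma smooth_step' c e : smooth_expr (step' c e).
Proof. by apply: SmoothMul; [exact: SmoothAffine|exact: SmoothCst]. Qed.

Lemma step_eq0 (c e t : R) : 0 < e -> t <= c -> step c e t = 0.
Proof.
by move=> e0 tc; rewrite /step eta0// step_arg ler_pdivrMr// mul0r subr_le0.
Qed.

Lemma step_eq1 (c e t : R) : 0 < e -> c + e <= t -> step c e t = 1.
Proof.
by move=> e0 tc; rewrite /step eta1// step_arg ler_pdivlMr// mul1r lerBrDl.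
Qed.

Lemma step'_eq0 (c e t : R) : 0 < e -> t <= c \/ c + e < t -> step' c e t = 0.
Proof.
move=> e0 H; rewrite /step' eta'0 ?mul0r// step_arg.
case: H => H; [left|right].
  by rewrite ler_pdivrMr// mul0r subr_le0.
by rewrite ltr_pdivlMr// mul1r ltrBrDl.
Qed.

Lemma Rintegral_step' (c e : R) : 0 < e ->
  \int[leb]_(t in `]c, (c + e)%R]) step' c e t = 1.
Proof.
move=> e0; have ce : c < c + e by rewrite ltrDl.
have cs : continuous (step' c e) by exact/smooth_expr_continuous/smooth_step'.
have ccs : continuous (step c e) by exact/smooth_expr_continuous/smooth_step_fun.
have ic : leb.-integrable `[c, (c + e)%R] (EFin \o step' c e).
  apply: continuous_compact_integrable; first exact: segment_compact.
  exact: continuous_subspaceT.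
rewrite Rintegral_itv_obnd_cbnd; last first.
  by apply: integrableS ic => //; exact: subset_itv_oc_cc.
rewrite /Rintegral (@continuous_FTC2 _ _ (step c e))//.
- by rewrite -EFinB /= (step_eq0 e0 (lexx _)) (step_eq1 e0 (lexx _)) subr0.
- exact: continuous_subspaceT.
- split.
  + by move=> x _; case: (is_derive_step c e x).
  + exact/cvg_at_right_filter/ccs.
  + exact/cvg_at_left_filter/ccs.
- by move=> x _; rewrite derive1E; case: (is_derive_step c e x).
Qed.

Lemma step'_le (c e t : R) : 0 < e -> `|step' c e t| <= C / e.
Proof.
move=> e0; rewrite /step' normrM (gtr0_norm (_ : 0 < e^-1)) ?invr_gt0//.
by rewrite ler_pM2r ?invr_gt0.
Qed.

Lemma measurable_step' c e : measurable_fun (I10 : set (measurableTypeR R)) (step' c e).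
Proof.
apply: measurable_funTS; apply: continuous_measurable_fun.
exact/smooth_expr_continuous/smooth_step'.
Qed.

Lemma step'_mul_integrable (k : R -> R) c e : 0 < e ->
  leb.-integrable I10 (EFin \o k) ->
  leb.-integrable I10 (EFin \o (fun t => step' c e t * k t)).
Proof.
move=> e0; apply: (bounded_mul_integrable_I10 (measurable_step' c e) (M := C / e)).
by move=> x _; exact: step'_le.
Qed.

(** The kernel [step'] has mass 1 on an interval of length e and height at most C / e, so the error
    is at most C / e times the integral of |k - k c| there. *)
Lemma step'_approx (k : R -> R) (c e : R) :
  leb.-integrable I10 (EFin \o k) -> -1 < c -> 0 < e -> c + e <= 0 ->
  davg (k \_ I10) c (2 * e) \is a fin_num ->
  `|\int[leb]_(t in I10) (step' c e t * k t) - k c| <=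
    4 * C * fine (davg (k \_ I10) c (2 * e)).
Proof.
move=> ik c1 e0 ce0 fd.
have c0 : c <= 0 by lra.
have N10 : (-1 : R) <= 0 by lra.
have ce : c <= c + e by lra.
have isk := step'_mul_integrable c e0 ik.
have ik1 : leb.-integrable I10 (EFin \o cst (k c)).
  by apply: (bounded_integrable_I10 (M := `|k c|)) => //; exact: measurable_cst.
have isk1 := step'_mul_integrable c e0 ik1.
have -> : \int[leb]_(t in I10) (step' c e t * k t) =
    \int[leb]_(t in `]c, (c + e)%R]) (step' c e t * k t).
  rewrite Rintegral_I10_itvoc//.
  rewrite (@Rintegral_itvoc_cat _ _ (-1) c 0)//; last exact: ltW.
  rewrite (@Rintegral_itvoc_cat _ _ c (c + e) 0)//; last exact: ltW.
  rewrite (_ : \int[leb]_(x in `](-1), c]) _ = 0); last first.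
    rewrite (@eq_Rintegral _ _ _ _ _ (fun=> 0)).
      by rewrite Rintegral_cst// mul0r.
    move=> x; rewrite inE /= in_itv/= => /andP[_ xc].
    by rewrite step'_eq0 ?mul0r//; left.
  rewrite (_ : \int[leb]_(x in `](c + e)%R, 0]) _ = 0) ?add0r ?addr0//.
  rewrite (@eq_Rintegral _ _ _ _ _ (fun=> 0)).
    by rewrite Rintegral_cst// mul0r.
  move=> x; rewrite inE /= in_itv/= => /andP[xc _].
  by rewrite step'_eq0 ?mul0r//; right.
have S1 := integrable_itvoc (ltW c1) ce0 isk.
have S2 := integrable_itvoc (ltW c1) ce0 isk1.
have S3 := integrable_itvoc (ltW c1) ce0 ik.
have S4 := integrable_itvoc (ltW c1) ce0 ik1.
have -> : k c = \int[leb]_(t in `]c, (c + e)%R]) (step' c e t * k c).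
  rewrite RintegralZr//; first by rewrite Rintegral_step'// mul1r.
  apply: (integrable_itvoc (ltW c1) ce0).
  apply: (bounded_integrable_I10 (measurable_step' c e) (M := C / e)).
  by move=> x _; exact: step'_le.
rewrite -RintegralB//.
have iD : leb.-integrable `]c, (c + e)%R] (EFin \o (fun x => k x - k c)).
  exact: integrable_sub.
apply: (le_trans (le_normr_Rintegral _ _)) => //.
  exact: integrable_sub.
have C0 : 0 <= C by apply: le_trans (eta'_le 0).
apply: (@le_trans _ _ (\int[leb]_(t in `]c, (c + e)%R]) (C / e * `|k t - k c|))).
  apply: le_Rintegral => //.
  - by apply: integrable_normr => //; exact: integrable_sub.
  - by apply: integrable_scale => //; exact: integrable_normr.
  by move=> x _; rewrite -mulrBr normrM; apply: ler_wpM2r => //; exact: step'_le.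
rewrite RintegralZl//; last exact: integrable_normr.
have := Rintegral_davg_le ik c1 e0 ce0 fd.
set I := \int[_]_(x in _) _; set f := fine _ => H.
rewrite (_ : 4 * C * f = C / e * (4 * e * f)); last by field; lra.
by apply: ler_wpM2l => //; rewrite divr_ge0// ltW.
Qed.

Lemma step'_cvg (k : R -> R) (c d : R) :
  leb.-integrable I10 (EFin \o k) -> -1 < c -> 0 < d -> c + d <= 0 ->
  lebesgue_pt (k \_ I10) c ->
  \int[leb]_(t in I10) (step' c (d * n.+1%:R^-1) t * k t) @[n --> \oo] --> k c.
Proof.
move=> ik c1 d0 cd0 lc.
have dn0 n : 0 < d * n.+1%:R^-1 by rewrite mulr_gt0.
have dnd n : d * n.+1%:R^-1 <= d.
  by rewrite ler_piMr ?(ltW d0)// invf_le1// ler1n.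
(* [lebesgue_pt] is a limit along positive radii, so positivity has to accompany the convergence to
   0. *)
have d2 : 2 * (d * n.+1%:R^-1) @[n --> \oo] --> (0 : R)^'+.
  have : 2 * (d * n.+1%:R^-1) @[n --> \oo] --> (2 * (d * 0) : R).
    by do 2 apply: cvgMr; exact: cvg_harmonic.
  rewrite !mulr0 => H A HA.
  have HA' : \forall n \near \oo, 0 < 2 * (d * n.+1%:R^-1) ->
    A (2 * (d * n.+1%:R^-1)) := H _ HA.
  by apply: filterS HA' => n An; apply: An; apply: mulr_gt0.
have H : davg (k \_ I10) c (2 * (d * n.+1%:R^-1)) @[n --> \oo] --> 0%E.
  by apply: cvg_trans lc; exact: cvg_app d2.
have [Hf Hc] := (fine_cvgP _ _).1 H.
apply/cvgrPdist_le => eps eps0.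
have : 4 * C * fine (davg (k \_ I10) c (2 * (d * n.+1%:R^-1))) @[n --> \oo] --> (4 * C * 0 : R).
  by apply: cvgMr.
rewrite mulr0 => /cvgrPdist_le /(_ _ eps0) He.
near=> n.
rewrite distrC; apply: (le_trans (step'_approx ik c1 (dn0 n) _ _)).
- by rewrite (le_trans _ cd0)// lerD2l.
- by near: n; exact: Hf.
apply: (le_trans (ler_norm _)); rewrite -normrN -[- _]sub0r.
by near: n; exact: He.
Unshelve. all: by end_near. Qed.

Lemma test_function_step (a b e : R) : -1 < a -> a <= b -> 0 < e -> b + e < 0 ->
  test_function (fun t => step a e t - step b e t).
Proof.
move=> a1 ab e0 be0; split.
  move=> n t; apply: smooth_expr_derivable; apply: smooth_expr_derivable_n.
  rewrite (_ : (fun t => _ - _) = (fun t => step a e t + -1 * step b e t)).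
    apply: SmoothAdd; first exact: smooth_step_fun.
    by apply: SmoothMul; [exact: SmoothCst|exact: smooth_step_fun].
  by apply/funext => x; rewrite mulN1r.
exists a, (b + e); split => // t; rewrite negb_and -!ltNge => /orP[ta|bt].
  by rewrite !step_eq0 ?subrr// ltW// (lt_le_trans ta).
by rewrite !step_eq1 ?subrr// ltW// (le_lt_trans _ bt)// lerD2r.
Qed.

Lemma derive1_step_sub (a b e t : R) :
  derive1 (fun t => step a e t - step b e t) t = step' a e t - step' b e t.
Proof.
rewrite derive1E.
by case: (is_deriveB (is_derive_step a e t) (is_derive_step b e t)).
Qed.

(** Each step vanishes at its own foot c and is eventually 1 at any point beyond it; hence the limit
    excludes a and includes b. *)
Lemma step_sub_cvg (a b d t : R) : 0 < d -> a < b ->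
  step a (d * n.+1%:R^-1) t - step b (d * n.+1%:R^-1) t @[n --> \oo] -->
  (\1_(`]a, b]) t : R).
Proof.
move=> d0 ab.
have dn0 n : 0 < d * n.+1%:R^-1 by rewrite mulr_gt0.
have dn : d * n.+1%:R^-1 @[n --> \oo] --> (0 : R).
  by rewrite -(mulr0 d); apply: cvgMr; exact: cvg_harmonic.
have near1 c : c < t -> \forall n \near \oo, step c (d * n.+1%:R^-1) t = 1.
  move=> ct; have tc0 : 0 < t - c by rewrite subr_gt0.
  have /cvgrPdist_lt /(_ _ tc0) dnt := dn.
  near=> n; apply: step_eq1 => //.
  rewrite -lerBrDl ltW//.
  have : `|0 - d * n.+1%:R^-1| < t - c.
    by near: n; exact: dnt.
  by rewrite sub0r normrN gtr0_norm.
rewrite indicE; case: (ltP a t) => at_; last first.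
  rewrite memNset; last by rewrite /= in_itv/= ltNge at_.
  apply: cvg_near_cst; apply: nearW => n.
  by rewrite !step_eq0 ?subrr// (le_trans at_)// ltW.
case: (leP t b) => tb.
  rewrite mem_set; last by rewrite /= in_itv/= at_.
  apply: cvg_near_cst; near=> n.
  rewrite [step b _ _]step_eq0// subr0; near: n; exact: near1.
rewrite memNset; last by rewrite /= in_itv/= [t <= b]leNgt tb andbF.
apply: cvg_near_cst; near=> n.
have -> : step a (d * n.+1%:R^-1) t = 1 by near: n; exact: near1.
have -> : step b (d * n.+1%:R^-1) t = 1 by near: n; exact: near1.
by rewrite subrr.
Unshelve. all: by end_near. Qed.

(** Test with a smoothed indicator of []a, b]]. As it sharpens, its derivative tends to the
    difference of the point masses at a and b, which the Lebesgue points make meaningful for k,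
    while the other side converges by domination. *)
Lemma du_bois_reymond_step (k g : R -> R) :
  leb.-integrable I10 (EFin \o k) -> leb.-integrable I10 (EFin \o g) ->
  (forall phi, test_function phi ->
     \int[leb]_(t in I10) (derive1 phi t * k t) =
     - \int[leb]_(t in I10) (phi t * g t)) ->
  forall a b, -1 < a -> a < b -> b < 0 ->
    lebesgue_pt (k \_ I10) a -> lebesgue_pt (k \_ I10) b ->
    k b - k a = \int[leb]_(t in `]a, b]) g t.
Proof.
move=> ik ig wk a b a1 ab b0 la lb.
(* Half the distance from b to 0, so that the falling edge after b stays inside the open
   interval. *)
pose d := - b / 2.
have d0 : 0 < d by rewrite /d; lra.
have bd : b + d < 0 by rewrite /d; lra.
have dn0 n : 0 < d * n.+1%:R^-1 by rewrite mulr_gt0.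
have dnd n : d * n.+1%:R^-1 <= d.
  by rewrite ler_piMr ?(ltW d0)// invf_le1// ler1n.
have ca := step'_cvg ik a1 d0 (_ : a + d <= 0) la.
have {}ca := ca ltac:(lra).
have cb := step'_cvg ik (lt_trans a1 ab) d0 (ltW bd) lb.
pose phi n t := step a (d * n.+1%:R^-1) t - step b (d * n.+1%:R^-1) t.
have tphi n : test_function (phi n).
  apply: test_function_step => //; first exact: ltW.
  by apply: le_lt_trans bd; rewrite lerD2l.
have mphi n : measurable_fun (I10 : set (measurableTypeR R)) (phi n).
  apply: measurable_funTS; apply: continuous_measurable_fun.
  by move=> x; apply: cvgB; exact/smooth_expr_continuous/smooth_step_fun.
have mg := integrable_I10_measurable ig.
have cphi : \int[leb]_(t in I10) (phi n t * g t) @[n --> \oo] -->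
    \int[leb]_(t in I10) (\1_(`]a, b]) t * g t).
  apply: (@Rintegral_dominated_cvg _ _ (fun t => 2 * `|g t|)).
  - by move=> n; exact: measurable_funM.
  - by apply: measurable_funM => //; exact: measurable_indic.
  - move=> t _; apply: cvgMl; exact: step_sub_cvg.
  - by apply: integrable_scale; [|apply: integrable_normr]; try exact: measurable_I10.
  move=> n t _; rewrite normrM ler_wpM2r//.
  by apply: (le_trans (ler_normB _ _)); rewrite (_ : 2 = 1 + 1)// lerD// eta_le1.
have E : \int[leb]_(t in I10) (\1_(`]a, b]) t * g t) = \int[leb]_(t in `]a, b]) g t.
  have -> : (`]a, b]%classic : set R) = I10 `&` `]a, b]%classic.
    by rewrite setIC setIidl//; apply: sub_itvoc_I10; exact: ltW.
  rewrite Rintegral_mkcondr; apply: eq_Rintegral => x Ix.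
  rewrite patchE indicE in_setI Ix /=; case: ifPn; rewrite ?mul1r ?mul0r//.
rewrite -E; apply/esym/eqP; rewrite -[X in X == _]opprK eqr_oppLR opprB; apply/eqP.
have cN : (- \int[leb]_(t in I10) (phi n t * g t)) @[n --> \oo] -->
    - \int[leb]_(t in I10) (\1_(`]a, b]) t * g t) by exact: cvgN.
apply: (cvg_unique _ cN) => //.
apply: (cvg_trans _ (cvgB ca cb)); apply: near_eq_cvg; apply: nearW => n.
transitivity (\int[leb]_(t in I10) (step' a (d * n.+1%:R^-1) t * k t) -
  \int[leb]_(t in I10) (step' b (d * n.+1%:R^-1) t * k t)) => //.
rewrite -(wk _ (tphi n)) -RintegralB//; try exact: step'_mul_integrable.
  by apply: eq_Rintegral => t _; rewrite derive1_step_sub mulrBl.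
exact: measurable_I10.
Qed.

End Step.

Lemma du_bois_reymond (k g : R -> R) :
  leb.-integrable I10 (EFin \o k) -> leb.-integrable I10 (EFin \o g) ->
  (forall phi, test_function phi ->
     \int[leb]_(t in I10) (derive1 phi t * k t) =
     - \int[leb]_(t in I10) (phi t * g t)) ->
  forall a b, -1 < a -> a < b -> b < 0 ->
    lebesgue_pt (k \_ I10) a -> lebesgue_pt (k \_ I10) b ->
    k b - k a = \int[leb]_(t in `]a, b]) g t.
Proof.
have [eta [eta' [C [seta [seta' deta] [eta0 eta1] eta_le1 [eta'_le eta'0]]]]] :=
  @smooth_step R.
exact: (du_bois_reymond_step seta seta' deta eta0 eta1 eta_le1 eta'_le eta'0).
Qed.

End DuBoisReymond.

(** * Continuous representatives of Sobolev functions *)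

Section ScalarWeakDerivative.
Context {R : realType} {X : completeNormedModType R}.
Local Notation leb := (@lebesgue_measure R).
Variable ip : X -> X -> R.
Hypothesis hX : is_hilbert ip.

Lemma Rintegral_sum_I10 (I : Type) (r : seq I) (f : I -> R -> R) :
  (forall i, leb.-integrable I10 (EFin \o f i)) ->
  leb.-integrable I10 (EFin \o (fun t => \sum_(i <- r) f i t)) /\
  \int[leb]_(t in I10) (\sum_(i <- r) f i t) =
  \sum_(i <- r) \int[leb]_(t in I10) f i t.
Proof.
have mI := @measurable_I10 R.
move=> fi; elim: r => [|i r [ih1 ih2]].
  rewrite big_nil; under eq_fun do rewrite big_nil; split.
    by apply: (bounded_integrable_I10 (M := 0)) => // x _; rewrite normr0.
  by rewrite Rintegral_cst// mul0r.
split.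
  under eq_fun do rewrite big_cons; exact: integrable_add.
by rewrite big_cons -ih2 -RintegralD//; apply: eq_Rintegral => t _; rewrite big_cons.
Qed.

Lemma simple_integral_ip (s : R -> X) (y : X) : simple_fun s ->
  leb.-integrable I10 (EFin \o (fun t => ip (s t) y)) /\
  \int[leb]_(t in I10) ip (s t) y = ip (simple_integral s) y.
Proof.
move=> [fs ms]; have mI := @measurable_I10 R.
pose r := fset_set (range s).
pose f v t := ip v y * \1_(s @^-1` [set v]) t.
have sE t : ip (s t) y = \sum_(v <- r) f v t.
  have rs : s t \in r by rewrite in_fset_set// inE; exists t.
  rewrite (bigD1_seq (s t))//=; last exact: fset_uniq.
  rewrite big1 ?addr0; last first.
    move=> v /negP vs; rewrite /f indicE memNset ?mulr0//= => sv.
    by apply: vs; rewrite sv.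
  by rewrite /f indicE mem_set ?mulr1.
have fi v : leb.-integrable I10 (EFin \o f v).
  apply: integrable_scale => //.
  apply: (bounded_integrable_I10 (M := 1)); first exact: measurable_indic.
  by move=> x _; rewrite indicE; case: (_ \in _); rewrite ?normr1 ?normr0 ?ler01.
have [iS eS] := Rintegral_sum_I10 r fi.
split.
  by apply: eq_integrable iS => // t _ /=; rewrite sE.
rewrite (@eq_Rintegral _ _ _ leb _ (fun t => \sum_(v <- r) f v t)); last by move=> t _; rewrite sE.
rewrite eS /simple_integral fsbig_finite//.
rewrite (_ : ip _ y = \sum_(v <- r)
    ip (fine (leb (I10 `&` s @^-1` [set v])) *: v) y); last first.
  have addip : {morph (fun v => ip v y) : u v / u + v} by move=> u v; exact: ipDl.
  exact: (big_morph _ addip (ip0l hX y)).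
apply: eq_bigr => v _; rewrite (ipZl hX) mulrC RintegralZl//; last first.
  apply: (bounded_integrable_I10 (M := 1)); first exact: measurable_indic.
  by move=> x _; rewrite indicE; case: (_ \in _); rewrite ?normr1 ?normr0 ?ler01.
congr (_ * _); by rewrite /Rintegral integral_indic// setIC.
Qed.

Lemma ip_cvg (u : nat -> X) (l y : X) :
  u n @[n --> \oo] --> l -> ip (u n) y @[n --> \oo] --> ip l y.
Proof.
move=> ul; apply/cvgrPdist_le => e e0.
have y0 : 0 < `|y| + 1 by rewrite ltr_wpDl.
have /cvgrPdist_le /(_ (e / (`|y| + 1))) H := ul.
near=> n; rewrite -(ipBl hX); apply: (le_trans (ip_cauchy_schwarz hX _ _)).
apply: (@le_trans _ _ (e / (`|y| + 1) * (`|y| + 1))); last by rewrite divfK// gt_eqF.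
apply: ler_pM => //; last by rewrite lerDl.
by near: n; apply: H; exact: divr_gt0.
Unshelve. all: by end_near. Qed.

(** By Cauchy-Schwarz the scalar error is at most |y| times the integral of |f - s n|. Measurability
    of these norms is assumed because [is_Bochner_integral] does not contain it. *)
Lemma Bochner_integral_ip (f : R -> X) (I y : X) :
  (forall s, simple_fun s ->
    measurable_fun (I10 : set (measurableTypeR R)) (fun t => `|f t - s t|)) ->
  leb.-integrable I10 (EFin \o (fun t => ip (f t) y)) ->
  is_Bochner_integral f I -> \int[leb]_(t in I10) ip (f t) y = ip I y.
Proof.
move=> mfs ify [s [ss cs cI]]; have mI := @measurable_I10 R.
have [Hf Hc] := (fine_cvgP _ _).1 cs.
apply: (cvg_unique _ _ (ip_cvg (y := y) cI)) => //.
apply/cvgrPdist_le => e e0.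
have : `|y| * fine (\int[leb]_(t in I10) (`|f t - s n t|)%:E) @[n --> \oo] --> `|y| * 0.
  exact: cvgMr.
rewrite mulr0 => /cvgrPdist_le /(_ _ e0) He.
near=> n.
have [is_ es] := simple_integral_ip y (ss n).
rewrite -es -RintegralB//.
have id : leb.-integrable I10 (EFin \o (fun t => ip (f t) y - ip (s n t) y)).
  exact: integrable_sub.
apply: (le_trans (le_normr_Rintegral mI id)).
have fin : (\int[leb]_(t in I10) (`|f t - s n t|)%:E)%E \is a fin_num.
  by near: n; exact: Hf.
have ifs : leb.-integrable I10 (EFin \o (fun t => `|f t - s n t|)).
  apply/integrableP; split; first by apply/measurable_EFinP; exact: mfs.
  under eq_integral do rewrite /= ger0_norm//.
  by rewrite ltey_eq fin.
apply: (@le_trans _ _ (\int[leb]_(t in I10) (`|y| * `|f t - s n t|))).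
  apply: le_Rintegral => //.
  - exact: integrable_normr.
  - exact: integrable_scale.
  by move=> t _; rewrite -(ipBl hX) mulrC; exact: ip_cauchy_schwarz.
have : `|0 - `|y| * fine (\int[leb]_(t in I10) (`|f t - s n t|)%:E)| <= e.
  by near: n; exact: He.
rewrite sub0r normrN RintegralZl//; exact: le_trans (ler_norm _).
Unshelve. all: by end_near. Qed.

(** Expanding the squared norm leaves only scalar functions already known to be measurable. *)
Lemma scaled_sub_measurable (h : R -> R) (f s : R -> X) :
  measurable_fun (I10 : set (measurableTypeR R)) h -> strongly_measurable f ->
  simple_fun s ->
  measurable_fun (I10 : set (measurableTypeR R)) (fun t => `|h t *: f t - s t|).
Proof.
move=> mh mf ss.
have ms : strongly_measurable s by exists (fun=> s) => // t _; exact: cvg_cst.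
have -> : (fun t => `|h t *: f t - s t|) =
    (fun t => Num.sqrt (h t ^+ 2 * `|f t| ^+ 2 - 2 * (h t * ip (f t) (s t)) + `|s t| ^+ 2)).
  apply/funext => t; rewrite -[LHS]ger0_norm// -sqrtr_sqr; congr Num.sqrt.
  rewrite -!(ip_sqr hX) !(ipBl hX, ipBr hX, ipZl hX, ipZr hX) (ipC hX (s t)); ring.
apply: (@measurableT_comp _ _ _ _ _ _ (@Num.sqrt R)).
  by apply: continuous_measurable_fun; exact: sqrt_continuous.
apply: measurable_funD; last first.
  by apply: measurable_funX; exact: strongly_measurable_norm.
apply: measurable_funB.
  apply: measurable_funM; first exact: measurable_funX.
  by apply: measurable_funX; exact: strongly_measurable_norm.
apply: measurable_funM; first exact: measurable_cst.
by apply: measurable_funM => //; exact: strongly_measurable_ip.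
Qed.

Lemma continuous_bounded_I10 (h : R -> R) : continuous h ->
  exists M, forall t, I10 t -> `|h t| <= M.
Proof.
move=> ch; have : bounded_set (h @` I10).
  apply: compact_bounded; apply: continuous_compact; last exact: segment_compact.
  exact: continuous_subspaceT.
move=> [M [_ HM]]; exists (M + 1) => x x01; apply: (HM (M + 1)); first by rewrite ltrDl.
by exists x.
Qed.

Lemma L2fun_ip_cst_integrable (f : L2fun X) (y : X) :
  leb.-integrable I10 (EFin \o (fun t => ip (f t) y)).
Proof.
apply: (@le_integrable _ _ _ leb _ _ _ (EFin \o (fun t => `|y| * `|f t|))).
- exact: measurable_I10.
- apply/measurable_EFinP.
  apply: strongly_measurable_ip => //; first exact: L2fun_measurable.
  exists (fun=> (fun=> y)) => [_|t _]; last exact: cvg_cst.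
  split; first by apply: (sub_finite_set _ (finite_set1 y)) => _ [x _ <-].
  by move=> v; rewrite preimage_cst; case: ifP.
- move=> t _; rewrite /= lee_fin; apply: le_trans (ler_norm _).
  by rewrite mulrC; exact: ip_cauchy_schwarz.
apply: integrable_scale; first exact: measurable_I10.
exact: L2fun_norm_integrable.
Qed.

Lemma scaled_Bochner_integral_ip (h : R -> R) (f : L2fun X) (I y : X) :
  continuous h -> is_Bochner_integral (fun t => h t *: f t) I ->
  \int[leb]_(t in I10) (h t * ip (f t) y) = ip I y.
Proof.
move=> ch hI.
have mh : measurable_fun (I10 : set (measurableTypeR R)) h.
  by apply: measurable_funTS; exact: continuous_measurable_fun.
have [M hM] := continuous_bounded_I10 ch.
have ify := L2fun_ip_cst_integrable f y.
rewrite -(@Bochner_integral_ip (fun t => h t *: f t) I y)//.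
- by apply: eq_Rintegral => t _; rewrite (ipZl hX).
- by move=> s ss; apply: scaled_sub_measurable => //; exact: L2fun_measurable.
- have := bounded_mul_integrable_I10 mh hM ify.
  by apply: eq_integrable; [exact: measurable_I10|move=> t _ /=; rewrite (ipZl hX)].
Qed.

Lemma weak_derivative_ip (f g : L2fun X) (y : X) : is_weak_derivative f g ->
  forall phi, test_function phi ->
    \int[leb]_(t in I10) (derive1 phi t * ip (f t) y) =
    - \int[leb]_(t in I10) (phi t * ip (g t) y).
Proof.
move=> fg phi tphi; have [I hI1 hI2] := fg _ tphi.
have [dphi _] := tphi.
rewrite (scaled_Bochner_integral_ip y _ hI1); last first.
  by move=> t; apply/differentiable_continuous/derivable1_diffP; exact: (dphi 1%N).
rewrite (scaled_Bochner_integral_ip y _ hI2); last first.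
  by move=> t; apply/differentiable_continuous/derivable1_diffP; exact: (dphi 0%N).
by rewrite (ipNl hX) opprK.
Qed.

End ScalarWeakDerivative.

Section AlmostEverywhere.
Context {R : realType}.
Local Notation leb := (@lebesgue_measure R).

Lemma ae_dense (P : R -> Prop) : {ae leb, forall t, P t} ->
  forall a b : R, a < b -> exists t, [/\ a < t, t < b & P t].
Proof.
move=> [N [mN N0 PN]] a b ab; apply/not_existsP => H.
have : (leb `]a, b[ <= leb N)%E.
  apply: le_measure; rewrite ?inE//.
  move=> t /=; rewrite in_itv/= => /andP[at_ tb]; apply: PN => Pt.
  by apply: (H t).
rewrite N0 lebesgue_measure_itv /= lte_fin ab -EFinB lee_fin.
by rewrite subr_le0 leNgt ab.
Qed.

Lemma ae_neq (c : R) : {ae leb, forall t, t <> c}.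
Proof.
exists [set c]; split => //; first exact: lebesgue_measure_set1.
by move=> t /= /contrapT.
Qed.

Lemma ae_finite_set (T : choiceType) (A : set T) (P : T -> R -> Prop) :
  finite_set A -> (forall v, A v -> {ae leb, forall t, P v t}) ->
  {ae leb, forall t v, A v -> P v t}.
Proof.
move=> /finite_seqP[r ->]; elim: r => [|v r ih] H; first exact: aeW.
have Hv : {ae leb, forall t, P v t} by apply: H => /=; exact: mem_head.
have Hr : {ae leb, forall t w, [set` r] w -> P w t}.
  by apply: ih => w wr; apply: H; rewrite /= inE wr orbT.
apply: (filterS2 _ _ Hv Hr) => t Pv Pr w /=.
by rewrite inE => /predU1P[->//|]; exact: Pr.
Qed.

End AlmostEverywhere.

Section UniformExtension.
Context {R : realType} {X : completeNormedModType R}.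

Lemma primitive_of_cvg (u g : R -> R) (e : nat -> R) (t : R) :
  primitive_of u g -> I10 t -> (forall n, I10 (e n)) ->
  e n @[n --> \oo] --> t -> u (e n) @[n --> \oo] --> u t.
Proof.
move=> ug; rewrite I10E => /andP[t1 t0] Ie et; apply/cvgrPdist_le => eps eps0.
have [d d0 H] := primitive_of_osc ug eps0.
have /cvgrPdist_lt /(_ _ d0) etd := et.
near=> n.
have := Ie n; rewrite I10E => /andP[e1 e0].
have : `|t - e n| < d by near: n; exact: etd.
have [te|et'] := leP t (e n).
  rewrite distrC ger0_norm ?subr_ge0// => ted.
  by apply: (H t (e n)).
rewrite ger0_norm ?subr_ge0 ?(ltW et')// => ted.
by apply: (H (e n) t); rewrite // ltW.
Unshelve. all: by end_near. Qed.

(** M serves as modulus of continuity: it is continuous, so along a sequence in E converging to t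
    its values are Cauchy, and those of F with them. The sequences stay in the conclusion so that
    relations between values of F can be passed to the limit. *)
Lemma uniform_extension (E : set R) (F : R -> X) (M g : R -> R) :
  primitive_of M g -> E `<=` I10 ->
  (forall t d, I10 t -> 0 < d -> exists2 e, E e & `|t - e| < d) ->
  (forall a b, E a -> E b -> `|F b - F a| <= `|M b - M a|) ->
  exists f : R -> X, (forall t, E t -> f t = F t) /\
    forall t, I10 t -> exists e : nat -> R,
      [/\ forall n, E (e n), e n @[n --> \oo] --> t
        & F (e n) @[n --> \oo] --> f t].
Proof.
move=> Mg EI Ed FM.
have H t : exists e : nat -> R, I10 t ->
    [/\ forall n, E (e n), e n @[n --> \oo] --> t & cvg (F (e n) @[n --> \oo])].
  have [It|nIt] := pselect (I10 t); last by exists (fun=> 0).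
  have He (n : nat) : {e | E e /\ `|t - e| < n.+1%:R^-1}.
    apply: cid; have n0 : (0 : R) < n.+1%:R^-1 by [].
    by have [e Ee te] := Ed t _ It n0; exists e.
  pose e n := sval (He n).
  have Ee n : E (e n) by have [] := svalP (He n).
  have et : e n @[n --> \oo] --> t.
    apply/cvgrPdist_lt => d d0; have /cvgrPdist_lt /(_ _ d0) hd := @cvg_harmonic R.
    near=> n.
    have [_ tn] := svalP (He n); apply: (lt_trans tn).
    have : `|0 - n.+1%:R^-1| < d by near: n; exact: hd.
    by rewrite sub0r normrN gtr0_norm.
  exists e => _; split => //.
  have Met := primitive_of_cvg Mg It (fun n => EI _ (Ee n)) et.
  apply/cauchy_cvgP/cauchyP => eps eps0.
  have eps2 : 0 < eps / 2 by rewrite divr_gt0.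
  have /cvgrPdist_lt /(_ _ eps2) [N _ HN] := Met.
  exists (F (e N)); exists N => // n /= Nn.
  rewrite -ball_normE /=; apply: (le_lt_trans (FM _ _ (Ee n) (Ee N))).
  have h1 := HN N (leqnn N); have h2 := HN n Nn.
  rewrite (_ : M (e N) - M (e n) = (M t - M (e n)) - (M t - M (e N))); last by ring.
  by rewrite (splitr eps); apply: (le_lt_trans (ler_normB _ _)); exact: ltrD.
have [e He] := choice H.
exists (fun t => lim (F (e t n) @[n --> \oo])); split; last first.
  by move=> t It; have [Ee et cF] := He t It; exists (e t).
move=> t Et; have It := EI _ Et; have [Ee et cF] := He t It.
apply/cvg_lim => //; apply/cvgrPdist_lt => eps eps0.
have Met := primitive_of_cvg Mg It (fun n => EI _ (Ee n)) et.
have /cvgrPdist_lt /(_ _ eps0) := Met.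
by apply: filterS => n; apply: le_lt_trans; exact: FM.
Unshelve. all: by end_near. Qed.

End UniformExtension.

Section WeakDerivative.
Context {R : realType} {X : completeNormedModType R}.
Local Notation leb := (@lebesgue_measure R).
Variable ip : X -> X -> R.
Hypothesis hX : is_hilbert ip.

Lemma I10_approx (P : R -> Prop) : {ae leb, forall t, P t} ->
  forall t d, I10 t -> 0 < d -> exists e, [/\ P e, -1 < e, e < 0 & `|t - e| < d].
Proof.
move=> hP t d; rewrite I10E => /andP[t1 t0] d0.
(* Cutting the ball down to the open interval leaves it nonempty even when t is an end point. *)
have ab : Num.max (-1) (t - d) < Num.min 0 (t + d).
  by rewrite gt_max !lt_min; apply/andP; split; apply/andP; split; lra.
have [e [ae eb Pe]] := ae_dense hP ab; exists e.
move: ae eb; rewrite gt_max lt_min => /andP[e1 te] /andP[e0 et].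
by split => //; rewrite ltr_norml; apply/andP; split; lra.
Qed.

Lemma Rintegral_ip_sub_le (g : L2fun X) (y z : X) (a b : R) :
  -1 <= a -> a <= b -> b <= 0 ->
  `|\int[leb]_(x in `]a, b]) ip (g x) y - \int[leb]_(x in `]a, b]) ip (g x) z|
    <= `|y - z| * \int[leb]_(x in `]a, b]) `|g x|.
Proof.
move=> a1 ab b0.
have iy := integrable_itvoc a1 b0 (L2fun_ip_cst_integrable hX g y).
have iz := integrable_itvoc a1 b0 (L2fun_ip_cst_integrable hX g z).
have ig := integrable_itvoc a1 b0 (L2fun_norm_integrable g).
rewrite -RintegralB// -RintegralZl//.
have id : leb.-integrable `]a, b] (EFin \o (fun x => ip (g x) y - ip (g x) z)).
  exact: integrable_sub.
apply: (le_trans (le_normr_Rintegral _ id)) => //.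
apply: le_Rintegral => //.
- exact: integrable_normr.
- exact: integrable_scale.
by move=> x _; rewrite -(ipBr hX) mulrC; exact: ip_cauchy_schwarz.
Qed.

(* Lebesgue points give the fundamental theorem tested against the countably many
   values of a simple approximation of [f], hence against the closed subspace they
   span; that subspace contains the increments of [f], so testing an increment
   against itself makes [f] uniformly continuous on a set of full measure. *)
Lemma weak_derivative_continuous (f g : L2fun X) : is_weak_derivative f g ->
  exists f0 : R -> X, [/\ ae_eq_I10 f0 f,
    forall s t, -1 <= s -> s <= t -> t <= 0 ->
      `|f0 t - f0 s| <= \int[leb]_(x in `]s, t]) `|g x|
  & forall r s t, I10 r -> -1 <= s -> s <= t -> t <= 0 ->
      ip (f0 t - f0 s) (f0 r) = \int[leb]_(x in `]s, t]) ip (g x) (f0 r)].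
Proof.
move=> fg; have [sn ssn sf] := L2fun_measurable f.
(* Each [sn n] has finitely many values, so these are countably many conditions, each true almost
   everywhere. *)
pose Q t := [/\ t <> -1, t <> 0 & forall n v, range (sn n) v ->
  lebesgue_pt ((fun x => ip (f x) v) \_ I10) t].
have Qae : {ae leb, forall t, Q t}.
  have H : {ae leb, forall t n v, range (sn n) v ->
      lebesgue_pt ((fun x => ip (f x) v) \_ I10) t}.
    apply: ae_foralln => n.
    apply: (ae_finite_set (P := fun v t => lebesgue_pt ((fun x => ip (f x) v) \_ I10) t)).
      by case: (ssn n).
    move=> v _; apply: lebesgue_differentiation.
    apply: integrable_locally_restrict; first exact: measurable_I10.
    exact: L2fun_ip_cst_integrable.
  apply: (filterS3 _ _ (ae_neq (-1)) (ae_neq 0) H) => t h1 h2 h3.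
  by split.
pose E : set R := [set t | [/\ Q t, -1 < t & t < 0]].
have EI : E `<=` I10.
  by move=> t [_ t1 t0]; rewrite I10E !ltW.
have Ed t d : I10 t -> 0 < d -> exists2 e, E e & `|t - e| < d.
  by move=> It d0; have [e [Qe e1 e0 te]] := I10_approx Qae It d0; exists e.
pose M t := \int[leb]_(x in `](-1), t]) `|g x|.
pose N y t := \int[leb]_(x in `](-1), t]) ip (g x) y.
have MP : primitive_of M (fun x => `|g x|).
  exact: primitive_of_integral (L2fun_norm_integrable g).
have NP y : primitive_of (N y) (fun x => ip (g x) y).
  exact: primitive_of_integral (L2fun_ip_cst_integrable hX g y).
(* Continuity of N in y: this lets the identity P below survive limits in y. *)
have NM y a b : I10 a -> I10 b -> `|N y b - N y a| <= `|y| * `|M b - M a|.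
  rewrite !I10E => /andP[a1 a0] /andP[b1 b0].
  wlog ab : a b a1 a0 b1 b0 / a <= b.
    move=> H; have [ab|/ltW ab] := leP a b; first exact: H.
    by rewrite distrC (distrC (M b)); exact: H.
  rewrite (NP y).2// MP.2// [X in _ <= _ * X]ger0_norm ?Rintegral_ge0//.
  have := Rintegral_ip_sub_le g y 0 a1 ab b0.
  rewrite subr0 (@eq_Rintegral _ _ _ leb _ (fun=> 0) (fun x => ip (g x) 0)).
    by rewrite Rintegral_cst// mul0r subr0.
  by move=> x _; rewrite (ipC hX) (ip0l hX).
have N_sub y z t : I10 t -> N (y - z) t = N y t - N z t.
  rewrite I10E => /andP[t1 t0]; rewrite /N -RintegralB//.
  - by apply: eq_Rintegral => x _; rewrite (ipBr hX).
  - exact: integrable_itvoc (lexx _) t0 (L2fun_ip_cst_integrable hX g y).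
  - exact: integrable_itvoc (lexx _) t0 (L2fun_ip_cst_integrable hX g z).
pose P y := forall a b, E a -> E b -> ip (f b - f a) y = N y b - N y a.
have P_range n v : range (sn n) v -> P v.
  move=> rv a b Ea Eb.
  wlog ab : a b Ea Eb / a <= b.
    move=> H; have [ab|/ltW ab] := leP a b; first exact: H.
    by rewrite -[f b - f a]opprB (ipNl hX) H// opprB.
  move: ab; rewrite le_eqVlt => /predU1P[->|ab].
    by rewrite !subrr (ip0l hX).
  have [[_ _ Qa] a1 a0] := Ea; have [[_ _ Qb] b1 b0] := Eb.
  rewrite (NP v).2 ?ltW// (ipBl hX).
  apply: (du_bois_reymond (k := fun x => ip (f x) v)) => //.
  - exact: L2fun_ip_cst_integrable.
  - exact: L2fun_ip_cst_integrable.
  - exact: weak_derivative_ip.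
  - exact: Qa rv.
  - exact: Qb rv.
have P_sub y z : P y -> P z -> P (y - z).
  move=> Py Pz a b Ea Eb; rewrite (ipBr hX) Py// Pz//.
  by rewrite !N_sub; [ring|exact: EI|exact: EI].
have P_lim (y : nat -> X) z : (forall n, P (y n)) -> y n @[n --> \oo] --> z -> P z.
  move=> Py yz a b Ea Eb.
  have c1 : ip (f b - f a) (y n) @[n --> \oo] --> ip (f b - f a) z.
    under eq_fun do rewrite (ipC hX); rewrite (ipC hX); exact: ip_cvg.
  apply: (cvg_unique _ c1) => //.
  have -> : (fun n => ip (f b - f a) (y n)) = (fun n => N (y n) b - N (y n) a).
    by apply/funext => n; rewrite Py.
  apply/cvgrPdist_le => eps eps0.
  have m0 : 0 < `|M b - M a| + 1 by rewrite ltr_wpDl.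
  have /cvgrPdist_le /(_ (eps / (`|M b - M a| + 1))) := yz.
  move=> /(_ (divr_gt0 eps0 m0)); apply: filterS => n yn.
  have -> : N z b - N z a - (N (y n) b - N (y n) a) = N (z - y n) b - N (z - y n) a.
    by rewrite !N_sub; [ring|exact: EI|exact: EI].
  apply: (le_trans (NM _ _ _ (EI _ Ea) (EI _ Eb))).
  apply: (@le_trans _ _ (eps / (`|M b - M a| + 1) * (`|M b - M a| + 1))); last first.
    by rewrite divfK// gt_eqF.
  by apply: ler_pM => //; rewrite lerDl.
(* The approximations converge at every t of the interval, so f t is a limit of vectors satisfying
   P, whether or not t lies in E. *)
have Pf t : I10 t -> P (f t).
  by move=> It; apply: (P_lim _ _ _ (sf t It)) => n; apply: (P_range n); exists t.
have fM a b : E a -> E b -> `|f b - f a| <= `|M b - M a|.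
  move=> Ea Eb.
  have := P_sub _ _ (Pf _ (EI _ Eb)) (Pf _ (EI _ Ea)) _ _ Ea Eb.
  rewrite (ip_sqr hX) => H.
  have := NM (f b - f a) _ _ (EI _ Ea) (EI _ Eb).
  rewrite -H ger0_norm ?sqr_ge0// expr2.
  have [->|n0] := eqVneq (f b - f a) 0; first by rewrite normr0.
  by rewrite ler_pM2l// normr_gt0.
have [f0 [f0E f0lim]] := uniform_extension MP EI Ed fM.
exists f0; split.
- apply: filterS Qae => t [t1 t0 Qt]; rewrite I10E => /andP[t1' t0'].
  apply: f0E; split; first by split.
    by rewrite lt_neqAle t1' andbT eq_sym; apply/eqP.
  by rewrite lt_neqAle t0' andbT; apply/eqP.
- move=> s t s1 st t0.
  have Is : I10 s by rewrite I10E s1 (le_trans st).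
  have It : I10 t by rewrite I10E t0 (le_trans s1).
  have [e [Ee et fe]] := f0lim t It; have [e' [Ee' es fe']] := f0lim s Is.
  have Me := primitive_of_cvg MP It (fun n => EI _ (Ee n)) et.
  have Me' := primitive_of_cvg MP Is (fun n => EI _ (Ee' n)) es.
  have -> : \int[leb]_(x in `]s, t]) `|g x| = `|M t - M s|.
    by rewrite MP.2// ger0_norm// Rintegral_ge0.
  apply: (ler_cvg_to (cvg_norm (cvgB fe fe')) (cvg_norm (cvgB Me Me'))).
  by apply: nearW => n; exact: fM.
(* The identity is available only against vectors satisfying P; [f0 r] is one, as a limit of values
   of f. *)
- move=> r s t Ir s1 st t0.
  have Is : I10 s by rewrite I10E s1 (le_trans st).
  have It : I10 t by rewrite I10E t0 (le_trans s1).
  have Pr : P (f0 r).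
    have [e [Ee et fe]] := f0lim r Ir.
    by apply: (P_lim _ _ _ fe) => n; apply: Pf; exact: EI.
  have [e [Ee et fe]] := f0lim t It; have [e' [Ee' es fe']] := f0lim s Is.
  have Ne := primitive_of_cvg (NP (f0 r)) It (fun n => EI _ (Ee n)) et.
  have Ne' := primitive_of_cvg (NP (f0 r)) Is (fun n => EI _ (Ee' n)) es.
  rewrite -(NP (f0 r)).2//.
  have c1 : ip (f (e n) - f (e' n)) (f0 r) @[n --> \oo] --> ip (f0 t - f0 s) (f0 r).
    exact: (ip_cvg hX (y := f0 r) (cvgB fe fe')).
  apply: (cvg_unique _ c1) => //.
  apply: cvg_trans (cvgB Ne Ne'); apply: near_eq_cvg; apply: nearW => n.
  by rewrite /= Pr.
Qed.

Lemma continuous_ae_eq_I10 (f h : R -> X) :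
  {within I10, continuous f} -> {within I10, continuous h} -> ae_eq_I10 f h ->
  forall t, I10 t -> f t = h t.
Proof.
move=> /subspace_continuousP cf /subspace_continuousP ch fh t It.
apply/eqP; rewrite -subr_eq0 -normr_eq0 eq_le normr_ge0 andbT.
apply/ler_addgt0Pl => eps eps0; rewrite addr0.
have eps2 : 0 < eps / 2 by rewrite divr_gt0.
have /cvgrPdist_lt /(_ _ eps2) := cf t It; rewrite near_withinE => Hf.
have /cvgrPdist_lt /(_ _ eps2) := ch t It; rewrite near_withinE => Hh.
have [d d0 Hd] := (nbhs_ballP _ _).1 (filterI Hf Hh).
have [e [fhe e1 e0 te]] := I10_approx fh It d0.
have Ie : I10 e by rewrite I10E !ltW.
have [/(_ Ie) h1 /(_ Ie) h2] := Hd e te.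
rewrite (_ : f t - h t = (f t - f e) - (h t - h e)); last first.
  by rewrite fhe// opprB addrA subrK.
by rewrite (splitr eps); apply: (le_trans (ler_normB _ _)); apply: lerD; exact: ltW.
Qed.

(** The properties of the constructed representative pass to the chosen one, because continuous
    functions that agree almost everywhere agree on all of [-1, 0], end points included. *)
Lemma W12_continuous_rep (F : L2 X) : W12 F ->
  let f := continuous_rep F in let g := L2rep (weak_derivative F) in
  [/\ ae_eq_I10 f (L2rep F),
    forall s t, -1 <= s -> s <= t -> t <= 0 ->
      `|f t - f s| <= \int[leb]_(x in `]s, t]) `|g x|
  & forall r s t, I10 r -> -1 <= s -> s <= t -> t <= 0 ->
      ip (f t - f s) (f r) = \int[leb]_(x in `]s, t]) ip (g x) (f r)].
Proof.
move=> FW f g.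
have Fg : is_weak_derivative (L2rep F) g by exact: (xgetPex 0 FW).
have [f0 [f0F f0M f0ip]] := weak_derivative_continuous Fg.
have cf0 : {within I10, continuous f0}.
  have MP := primitive_of_integral (L2fun_norm_integrable g).
  apply/subspace_continuousP => t It; apply/cvgrPdist_le => eps eps0.
  have [d d0 H] := primitive_of_osc MP eps0.
  near=> y.
  have : I10 y by near: y; exact: withinT.
  move: It; rewrite !I10E => /andP[t1 t0] /andP[y1 y0].
  have tyd : `|t - y| < d.
    by near: y; apply: cvg_within; apply/nbhs_ballP; exists d => //= z.
  have [ty|/ltW yt] := leP t y.
    rewrite distrC; apply: (le_trans (f0M _ _ t1 ty y0)).
    rewrite -MP.2//; apply: (le_trans (ler_norm _)).
    by apply: (H t y) => //; move: tyd; rewrite distrC ger0_norm ?subr_ge0.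
  apply: (le_trans (f0M _ _ y1 yt t0)).
  rewrite -MP.2//; apply: (le_trans (ler_norm _)).
  by apply: (H y t) => //; move: tyd; rewrite ger0_norm ?subr_ge0.
have [cf fF] : {within I10, continuous f} /\ ae_eq_I10 f (L2rep F).
  apply: (@xgetPex _ (fun=> 0)
    [set f | {within I10, continuous f} /\ ae_eq_I10 f (L2rep F)]).
  by exists f0.
have ff0 : forall t, I10 t -> f t = f0 t.
  apply: continuous_ae_eq_I10 => //.
  by apply: (filterS2 _ _ fF f0F) => t h1 h2 It; rewrite h1// h2.
split => //.
- move=> s t s1 st t0; rewrite !ff0 ?I10E ?t0 ?s1 ?(le_trans s1 st) ?(le_trans st t0)//.
  exact: f0M.
- move=> r s t Ir s1 st t0.
  rewrite (ff0 s) ?I10E ?s1 ?(le_trans st t0)// (ff0 t) ?I10E ?t0 ?(le_trans s1 st)//.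
  by rewrite (ff0 r)//; exact: f0ip.
Unshelve. all: by end_near. Qed.

End WeakDerivative.

(** * Dissipativity *)

Section Dissipativity.
Context {R : realType} {X : completeNormedModType R}.
Local Notation leb := (@lebesgue_measure R).
Variable ip : X -> X -> R.
Hypothesis hX : is_hilbert ip.

Lemma Rintegral_ae_le (D : set R) (h1 h2 : R -> R) : measurable D ->
  leb.-integrable D (EFin \o h1) -> leb.-integrable D (EFin \o h2) ->
  (forall x, 0 <= h1 x) -> (forall x, 0 <= h2 x) ->
  {ae leb, forall x, D x -> h1 x <= h2 x} ->
  \int[leb]_(x in D) h1 x <= \int[leb]_(x in D) h2 x.
Proof.
move=> mD i1 i2 p1 p2 h12; apply: fine_le.
- exact: integrable_fin_num.
- exact: integrable_fin_num.
apply: ae_ge0_le_integral => //.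
- by move=> x _; rewrite lee_fin.
- exact: measurable_int i1.
- by move=> x _; rewrite lee_fin.
- exact: measurable_int i2.
Qed.

(* Since [|f t|^2 - |f s|^2 = <f t - f s, f t> + <f t - f s, f s>], the defect is
   of second order on short intervals. *)
Lemma W12_sqr_norm_primitive (F : L2 X) : W12 F ->
  primitive_of (fun t => `|continuous_rep F t| ^+ 2)
    (fun t => 2 * ip (L2rep (weak_derivative F) t) (L2rep F t)).
Proof.
move=> FW; have [fF fM fip] := W12_continuous_rep hX FW.
set f := continuous_rep F in fF fM fip *.
set g := L2rep (weak_derivative F) in fM fip *.
have mI := @measurable_I10 R.
have igF : leb.-integrable I10 (EFin \o (fun t => 2 * ip (g t) (L2rep F t))).
  by apply: integrable_scale => //; exact: L2fun_ip_integrable.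
have ig := L2fun_norm_integrable g.
have PP := primitive_of_integral igF.
have MP := primitive_of_integral ig.
set P := fun t => \int[leb]_(x in `](-1), t]) (2 * _) in PP.
set M := fun t => \int[leb]_(x in `](-1), t]) `|g x| in MP.
split => // s t s1 st t0; rewrite -PP.2//.
suff : `|f t| ^+ 2 - P t = `|f s| ^+ 2 - P s by lra.
move: s t s1 st t0; apply: (@small_increments_constant _ _ (fun t => M t)) => e e0.
have e2 : 0 < e / 2 by rewrite divr_gt0.
have [d d0 H] := Rintegral_itvoc_small ig e2.
exists d => // s t s1 st t0 tsd.
have Is : I10 s by rewrite I10E s1 (le_trans st).
have It : I10 t by rewrite I10E t0 (le_trans s1).
have oc (k : R -> R) : leb.-integrable I10 (EFin \o k) ->
  leb.-integrable `]s, t] (EFin \o k) by exact: integrable_itvoc.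
have osc x y : s <= x -> x <= t -> s <= y -> y <= t -> `|f x - f y| <= e / 2.
  move=> sx xt sy yt.
  wlog yx : x y sx xt sy yt / y <= x.
    move=> W; have [yx|/ltW yx] := leP y x; first exact: W.
    by rewrite distrC; exact: W.
  apply: (le_trans (fM y x _ yx _)).
  - exact: le_trans sy.
  - exact: le_trans t0.
  apply: le_trans (ltW (H s t s1 st t0 tsd)).
  under [leRHS]eq_Rintegral do rewrite normr_id.
  by apply: Rintegral_itvoc_mono.
have it := L2fun_ip_cst_integrable hX g (f t).
have is_ := L2fun_ip_cst_integrable hX g (f s).
have -> : `|f t| ^+ 2 - P t - (`|f s| ^+ 2 - P s) =
    \int[leb]_(x in `]s, t]) (ip (g x) (f t) + ip (g x) (f s)
      - 2 * ip (g x) (L2rep F x)).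
  rewrite RintegralB//; [|by apply: integrable_add => //; exact: oc|exact: oc].
  rewrite RintegralD//; [|exact: oc|exact: oc].
  rewrite -PP.2// -!fip// !(ipBl hX) !(ip_sqr hX) (ipC hX (f s)); ring.
have iD : leb.-integrable `]s, t] (EFin \o (fun x => ip (g x) (f t) + ip (g x) (f s)
      - 2 * ip (g x) (L2rep F x))).
  by apply: integrable_sub => //; [apply: integrable_add => //|]; exact: oc.
apply: (le_trans (le_normr_Rintegral _ iD)) => //.
rewrite MP.2// -RintegralZl//; last exact: oc.
apply: Rintegral_ae_le => //.
- exact: integrable_normr.
- by apply: integrable_scale => //; exact: oc.
- by move=> x; rewrite mulr_ge0// ltW.
(* The chosen representative of the class F equals f only almost everywhere, so the integrands are
   compared almost everywhere. *)
apply: filterS fF => x fFx /=; rewrite in_itv/= => /andP[/ltW sx xt].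
rewrite -fFx; last by rewrite I10E (le_trans s1 sx) (le_trans xt t0).
have -> : ip (g x) (f t) + ip (g x) (f s) - 2 * ip (g x) (f x) =
    ip (g x) (f t - f x) + ip (g x) (f s - f x).
  by rewrite !(ipBr hX); ring.
apply: (le_trans (ler_normD _ _)).
rewrite (_ : e * `|g x| = `|g x| * (e / 2) + `|g x| * (e / 2)); last by field.
by apply: lerD; apply: (le_trans (ip_cauchy_schwarz hX _ _)); apply: ler_wpM2l => //;
  apply: osc.
Qed.

Variable B : operator X.
Variable zeta : R -> {linear X -> X}.
Hypothesis hzeta : forall t, I10 t -> bounded_op (zeta t).
Hypothesis hzeta_bv : op_bounded_variation zeta (-1) 0.
Variables lambda mu : R.
Hypothesis hlambda : dissipative ip (op_sub_scalar B lambda).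
Hypothesis hmu : lambda < mu.
Hypothesis hmu_large : (tv zeta 0 - tv zeta (-1)) * exp_tv_integral zeta mu (-1)
                 < (mu - lambda) ^+ 2.

Lemma delay_operator_dissipative :
  dissipative (weighted_ip ip (delay_weight zeta lambda mu))
    (op_sub_scalar (delay_operator B zeta) mu).
Proof.
move=> [x F] [/= Bx FW fx].
set tau := delay_weight zeta lambda mu.
set m := mu - lambda; have m0 : 0 < m by rewrite subr_gt0.
have mI := @measurable_I10 R.
have [a [b [a0 tau_ab]]] := delay_weight_bounds hzeta_bv hmu hmu_large.
have mtau := delay_weight_measurable hzeta_bv lambda mu.
have itau (k : R -> R) := delay_weight_mul_integrable hzeta_bv hmu hmu_large (g := k).
have uP := W12_sqr_norm_primitive FW.
have [fF _ _] := W12_continuous_rep hX FW.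
set f := continuous_rep F in uP fF fx.
set g := L2rep (weak_derivative F) in uP.
have vnd := tv_nondecreasing hzeta_bv.
have N10 : (-1 : R) <= 0 by rewrite lerN10.
have hJ := is_RS_integral_primitive uP vnd (lexx _) N10 (lexx _).
set J := (_ - _ - _) in hJ.
have PhiJ := RS_integral_op_sqr_le hzeta hzeta_bv hJ.
have parts := delay_weight_by_parts hzeta_bv hmu hmu_large uP hJ.
rewrite -/tau -/m in parts.
set V := tv zeta 0 - tv zeta (-1) in PhiJ parts.
have V0 : 0 <= V by exact: tv_width_ge0.
have J0 : 0 <= J.
  by apply: (is_RS_integral_ge0 vnd (lexx _) N10 (lexx _) _ hJ) => t; exact: sqr_ge0.
have tau1 : 0 <= tau (-1).
  have /tau_ab /andP[ta _] : I10 (-1 : R) by rewrite I10E lexx.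
  exact: le_trans (ltW a0) ta.
rewrite -[X in _ X (_, _)]/(op_fun B x + delay_Phi zeta F - mu *: x,
   weak_derivative F - mu *: F).
have -> : weak_derivative F - mu *: F = L2class (- mu *: L2rep F + g).
  by rewrite addrC -scaleNr L2_linE.
rewrite -[X in weighted_ip _ _ _ (_, X)]L2repK.
rewrite (weighted_ip_class hX a0 tau_ab mtau).
set Phi := delay_Phi zeta F.
have iFF := weighted_sqr_integrable hX a0 tau_ab mtau (L2rep F).
have igF := weighted_ip_integrable hX a0 tau_ab mtau g (L2rep F).
set Q := \int[leb]_(t in I10) (tau t * `|L2rep F t| ^+ 2).
set K := \int[leb]_(t in I10) (tau t * ip (g t) (L2rep F t)).
have -> : \int[leb]_(t in I10) (tau t * ip ((- mu *: L2rep F + g) t) (L2rep F t)) =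
    K - mu * Q.
  rewrite /K /Q -RintegralZl// -RintegralB//; last exact: integrable_scale.
  apply: eq_Rintegral => t _.
  rewrite (_ : L2fun_val (- mu *: L2rep F + g) t = - mu *: L2rep F t + g t)//.
  by rewrite (ip_linl hX) (ip_sqr hX); ring.
have K2 : \int[leb]_(t in I10) (tau t * (2 * ip (g t) (L2rep F t))) = 2 * K.
  by rewrite /K -RintegralZl//; apply: eq_Rintegral => t _; ring.
have QE : \int[leb]_(t in I10) (tau t * `|f t| ^+ 2) = Q.
  apply: eq_ae_Rintegral_I10.
  - apply: measurable_funM => //; exact: primitive_of_measurable uP.
  - exact: integrable_I10_measurable iFF.
  - by apply: filterS fF => t h It; rewrite h.
(* The domain condition f(0) = x turns the boundary term at 0 into m |x|^2. *)
rewrite K2 QE fx in parts.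
have diss : ip (op_fun B x) x <= lambda * `|x| ^+ 2.
  have := hlambda Bx; rewrite /= (ipBl hX) (ipZl hX) (ip_sqr hX); lra.
rewrite (ipBl hX) (ipDl hX) (ipZl hX) (ip_sqr hX).
have PhiE : `|Phi| ^+ 2 <= V * J by [].
(* Young's inequality from (|Phi| - m |x|)^2 >= 0; the weight m is the one that yields the
   coefficient V / m of J found in [parts]. *)
have Phix : ip Phi x <= m / 2 * `|x| ^+ 2 + V / m * J / 2.
  apply: (le_trans (ler_norm _)); apply: (le_trans (ip_cauchy_schwarz hX _ _)).
  have sq : 0 <= (`|Phi| - m * `|x|) ^+ 2 by exact: sqr_ge0.
  rewrite (_ : _ + _ = (m ^+ 2 * `|x| ^+ 2 + V * J) / (2 * m)); last first.
    by field; rewrite gt_eqF.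
  rewrite ler_pdivlMr ?mulr_gt0//; nra.
have t1u : 0 <= tau (-1) * `|f (-1)| ^+ 2 by rewrite mulr_ge0// sqr_ge0.
(* The - m |x|^2 from B - mu cancels the two halves from [Phix] and [parts]; the terms in Q and in J
   cancel too, and what is left is at most - tau(-1) |f(-1)|^2 / 2. *)
rewrite /m in parts Phix *; lra.
Qed.

End Dissipativity.

Theorem theorem3p2 (R : realType) (X : completeNormedModType R)
    (ip : X -> X -> R) (hX : is_hilbert ip)
    (B : operator X) (hB : generates_C0_semigroup B)
    (zeta : R -> {linear X -> X})
    (hzeta : forall t, I10 t -> bounded_op (zeta t))
    (hzeta_bv : op_bounded_variation zeta (-1) 0)
    (lambda mu : R)
    (hlambda : dissipative ip (op_sub_scalar B lambda))
    (hmu : lambda < mu)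
    (hmu_large : (tv zeta 0 - tv zeta (-1)) * exp_tv_integral zeta mu (-1)
                 < (mu - lambda) ^+ 2) :
  let p := weighted_ip ip (delay_weight zeta lambda mu) in
  [/\ weighted_ip_well_defined ip (delay_weight zeta lambda mu),
      is_inner_product p,
      equivalent_ip p (canonical_ip ip)
    & dissipative p (op_sub_scalar (delay_operator B zeta) mu)].

Proof.
have [a [b [a0 tau_ab]]] := delay_weight_bounds hzeta_bv hmu hmu_large.
have mtau := delay_weight_measurable hzeta_bv lambda mu.
split.
- exact: (weighted_ip_well_definedP hX a0 tau_ab mtau).
- exact: (weighted_ip_inner_product hX a0 tau_ab mtau).
- exact: (weighted_ip_equivalent hX a0 tau_ab mtau).
- exact: delay_operator_dissipative.
Qed.
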